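(* Let $\mathbf{C}$ be a finitely complete category such that the category $\mathsf{Cat}(\mathbf{C})$ of internal categories in $\mathbf{C}$ is finitely complete and finitely cocomplete. Let $\tau_{triv}$ denote the trivial Grothendieck topology on $\mathbf{C}$. Then the following hold. (i) A morphism $p$ in $\mathbf{C}$ is $\tau_{triv}$-epi if and only if there exists a morphism $q$ such that $pq=\mathrm{id}$. (ii) An internal functor $F$ is an acyclic $\tau_{triv}$-fibration (i.e. both a $\tau_{triv}$-fibration and a $\tau_{triv}$-equivalence) if and only if there exists an internal functor $G$ such that $FG=\mathrm{id}$ and $GF\cong\mathrm{id}$. (iii) Every object of $\mathbf{C}$ is $\tau_{triv}$-projective, and hence $\mathbf{C}$ has enough $\tau_{triv}$-projectives. (iv) Assume from now on that the $\tau_{triv}$-equivalences have the 2-out-of-3 property. Then the $\tau_{triv}$-equivalences, $\tau_{triv}$-fibrations and $\tau_{triv}$-cofibrations are the weak equivalences, fibrations and cofibrations of a model structure on $\mathsf{Cat}(\mathbf{C})$ (the $\tau_{triv}$-model structure). (v) Every object of $\mathsf{Cat}(\mathbf{C})$ is fibrant and cofibrant. (vi) The weak equivalences in the $\tau_{triv}$-model structure are precisely the equivalences in the 2-category $\mathsf{Cat}(\mathbf{C})$. (vii) The $\tau_{triv}$-model structure coincides with the trivial model structure on the underlying category of the 2-category $\mathcal{K}=\mathsf{Cat}(\mathbf{C})$.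
   Context: $\mathsf{Cat}(\mathbf{C})$ is the 2-category of internal categories, internal functors and internal natural transformations in $\mathbf{C}$; an internal category $\mathbb{B}$ has object-of-objects $\mathbb{B}_0$, object-of-morphisms $\mathbb{B}_1$, and source and target $s,t:\mathbb{B}_1\to\mathbb{B}_0$. $\cong$ denotes internal natural isomorphism. In the trivial topology the only covering sieve on an object is the maximal sieve. For a Grothendieck topology $\mathcal{T}$ on $\mathbf{C}$, a morphism $p:E\to B$ is $\mathcal{T}$-epi if its image under the Yoneda embedding followed by sheafification is an epimorphism of sheaves; equivalently, for every $g:X\to B$ there are a covering sieve $\{f_i:U_i\to X\}$ and morphisms $u_i:U_i\to E$ with $pu_i=gf_i$ for all $i$. An object $P$ of $\mathbf{C}$ is $\mathcal{T}$-projective if for every $\mathcal{T}$-epi $G:Q\to R$ and every $H:P\to R$ there is $F:P\to Q$ with $GF=H$. $\mathbf{C}$ has enough $\mathcal{T}$-projectives if every object admits a $\mathcal{T}$-epi from a $\mathcal{T}$-projective. Let $\mathsf{iso}:\mathsf{Cat}(\mathbf{C})\to\mathsf{Grpd}(\mathbf{C})$ be the right adjoint to the inclusion of internal groupoids ($\mathsf{iso}(\mathbb{B})_0=\mathbb{B}_0$ and $\mathsf{iso}(\mathbb{B})_1\subseteq\mathbb{B}_1$ is the object of internal isomorphisms). For an internal functor $F:\mathbb{A}\to\mathbb{B}$ let $(\mathbb{P}_F)_0=\mathbb{A}_0\times_{\mathbb{B}_0}\mathsf{iso}(\mathbb{B})_1$ be the pullback of $F_0$ and $t:\mathsf{iso}(\mathbb{B})_1\to\mathbb{B}_0$,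 with projection $\overline F_0:(\mathbb{P}_F)_0\to\mathsf{iso}(\mathbb{B})_1$. $F$ is a $\mathcal{T}$-equivalence if $s\circ\overline F_0:(\mathbb{P}_F)_0\to\mathbb{B}_0$ is $\mathcal{T}$-epi and $F$ is fully faithful, i.e. the square formed by $F_1$, $F_0\times F_0$ and the morphisms $(s,t):\mathbb{A}_1\to\mathbb{A}_0\times\mathbb{A}_0$, $(s,t):\mathbb{B}_1\to\mathbb{B}_0\times\mathbb{B}_0$ is a pullback in $\mathbf{C}$. $F$ is a $\mathcal{T}$-fibration if the induced morphism $\mathsf{iso}(\mathbb{A})_1\to(\mathbb{P}_F)_0$ (with components $t$ and $\mathsf{iso}(F)_1$) is $\mathcal{T}$-epi. $F$ is a $\mathcal{T}$-cofibration if it has the left lifting property with respect to all acyclic $\mathcal{T}$-fibrations. Trivial model structure (Lack): on the underlying category of any 2-category $\mathcal{K}$ with finite limits and finite colimits there is a model structure in which $f:A\to B$ is a weak equivalence (respectively fibration) if and only if for every object $E$ the functor $\mathcal{K}(E,f):\mathcal{K}(E,A)\to\mathcal{K}(E,B)$ is an equivalence of categories (respectively an isofibration, i.e. every isomorphism $b\cong \mathcal{K}(E,f)(a)$ lifts to an isomorphism $a'\cong a$). In particular the weak equivalences are the equivalences in $\mathcal{K}$. *)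

(* Defs.v *)
From Corelib Require Import ssreflect ssrfun ssrbool.
From Stdlib Require Import FinFun ClassicalEpsilon FunctionalExtensionality
  ProofIrrelevance.

Set Implicit Arguments.
Unset Strict Implicit.
Unset Printing Implicit Defensive.

Declare Scope cat_scope.
Delimit Scope cat_scope with cat.
Local Open Scope cat_scope.

Record Category := {
  Ob :> Type;
  Hom : Ob -> Ob -> Type;
  idm : forall a, Hom a a;
  comp : forall a b c, Hom b c -> Hom a b -> Hom a c;
  comp_id_l : forall a b (f : Hom a b), comp (idm b) f = f;
  comp_id_r : forall a b (f : Hom a b), comp f (idm a) = f;
  comp_assoc : forall a b c d (h : Hom c d) (g : Hom b c) (f : Hom a b),
    comp h (comp g f) = comp (comp h g) f
}.
Arguments Hom {c0} a b.
Arguments idm {c0} a.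
Arguments comp {c0} {a b c} g f.
Arguments comp_assoc {c0} {a b c d} h g f.

Notation "g ∘ f" := (comp g f) (at level 40, left associativity) : cat_scope.

Definition is_iso (C : Category) (a b : C) (f : Hom a b) : Prop :=
  exists g : Hom b a, g ∘ f = idm a /\ f ∘ g = idm b.

Definition isomorphic (C : Category) (a b : C) : Prop :=
  exists f : Hom a b, is_iso f.

Record Functor (C D : Category) := {
  fob :> C -> D;
  fmap : forall a b, Hom a b -> Hom (fob a) (fob b);
  fmap_id : forall a, fmap (idm a) = idm (fob a);
  fmap_comp : forall a b c (g : Hom b c) (f : Hom a b),
    fmap (g ∘ f) = fmap g ∘ fmap f
}.
Arguments fmap {C D} _ {a b} _.

Lemma fob_eq (C D : Category) (F G : Functor C D) :
  F = G -> forall a, F a = G a.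
Proof. by move=> ->. Qed.

Definition Fid (C : Category) : Functor C C.
Proof. by exists (fun a => a) (fun _ _ f => f). Defined.

Definition Fcomp (C D E : Category) (G : Functor D E) (F : Functor C D) :
  Functor C E.
Proof.
exists (fun a => G (F a)) (fun _ _ f => fmap G (fmap F f)).
- by move=> a; rewrite !fmap_id.
- by move=> a b c g f; rewrite !fmap_comp.
Defined.

Definition Fconst (C D : Category) (d : D) : Functor C D.
Proof.
exists (fun _ => d) (fun _ _ _ => idm d) => //.
by move=> *; rewrite comp_id_l.
Defined.

Definition ProdCat (C D : Category) : Category.
Proof.
exists (C * D)%type (fun p q => (Hom (fst p) (fst q) * Hom (snd p) (snd q))%type)
  (fun p => (idm (fst p), idm (snd p)))
  (fun _ _ _ g f => (fst g ∘ fst f, snd g ∘ snd f)).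
- by move=> a b [f g] /=; rewrite !comp_id_l.
- by move=> a b [f g] /=; rewrite !comp_id_r.
- by move=> a b c d h g f /=; rewrite !comp_assoc.
Defined.

Definition Ffst (C D : Category) : Functor (ProdCat C D) C.
Proof. by exists (fun p : ProdCat C D => fst p) (fun _ _ f => fst f). Defined.

Definition Fsnd (C D : Category) : Functor (ProdCat C D) D.
Proof. by exists (fun p : ProdCat C D => snd p) (fun _ _ f => snd f). Defined.

Definition Fpair (C D E : Category) (F : Functor E C) (G : Functor E D) :
  Functor E (ProdCat C D).
Proof.
exists (fun e => (F e, G e) : ProdCat C D)
  (fun _ _ f => (fmap F f, fmap G f)).
- by move=> a; rewrite !fmap_id.
- by move=> a b c g f; rewrite !fmap_comp.
Defined.

Definition nat_iso (C D : Category) (F G : Functor C D) : Prop :=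
  exists al : forall a, Hom (F a) (G a),
    (forall a b (f : Hom a b), al b ∘ fmap F f = fmap G f ∘ al a) /\
    (forall a, is_iso (al a)).

Definition is_equivalence (C D : Category) (F : Functor C D) : Prop :=
  exists G : Functor D C,
    nat_iso (Fcomp G F) (Fid C) /\ nat_iso (Fcomp F G) (Fid D).

(* Equality in the sigma type says that the object [F a'] is [b] and that,
   modulo this identification, [F al] is [be]. *)
Definition is_isofibration (C D : Category) (F : Functor C D) : Prop :=
  forall (a : C) (b : D) (be : Hom b (F a)), is_iso be ->
  exists (a' : C) (al : Hom a' a), is_iso al /\
    existT (fun y => Hom y (F a)) (F a') (fmap F al) =
    existT (fun y => Hom y (F a)) b be.

(* Categories enriched in categories; the associativity and unit laws are
   equalities of functors, so they cover 1-cells and 2-cells at once. *)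
Record TwoCategory := {
  cell0 :> Type;
  HomC : cell0 -> cell0 -> Category;
  one : forall A, HomC A A;
  hcomp : forall A B D, Functor (ProdCat (HomC B D) (HomC A B)) (HomC A D);
  hcomp_one_l : forall A B,
    Fcomp (hcomp A B B) (Fpair (Fconst (HomC A B) (one B)) (Fid (HomC A B))) =
    Fid (HomC A B);
  hcomp_one_r : forall A B,
    Fcomp (hcomp A A B) (Fpair (Fid (HomC A B)) (Fconst (HomC A B) (one A))) =
    Fid (HomC A B);
  hcomp_assoc : forall A B D E,
    let p1 := Ffst (HomC D E) (ProdCat (HomC B D) (HomC A B)) in
    let p2 := Fcomp (Ffst (HomC B D) (HomC A B)) (Fsnd (HomC D E) _) in
    let p3 := Fcomp (Fsnd (HomC B D) (HomC A B)) (Fsnd (HomC D E) _) in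
    Fcomp (hcomp A D E) (Fpair p1 (Fcomp (hcomp A B D) (Fpair p2 p3))) =
    Fcomp (hcomp A B E) (Fpair (Fcomp (hcomp B D E) (Fpair p1 p2)) p3)
}.
Arguments one {t} A.
Arguments hcomp {t} A B D.

Definition underlying (K : TwoCategory) : Category.
Proof.
unshelve refine {| Ob := K; Hom := @HomC K; idm := one;
  comp := fun A B D g f => hcomp A B D (g, f) |}.
- by move=> A B f; exact: (fob_eq (hcomp_one_l A B) f).
- by move=> A B f; exact: (fob_eq (hcomp_one_r A B) f).
- move=> A B D E h g f.
  exact: (fob_eq (hcomp_assoc A B D E) (h, (g, f))).
Defined.

(* K(E, f) : K(E, A) -> K(E, B) *)
Definition postcomp (K : TwoCategory) (E A B : K) (f : HomC A B) :
  Functor (HomC E A) (HomC E B) :=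
  Fcomp (hcomp E A B) (Fpair (Fconst (HomC E A) f) (Fid (HomC E A))).

Definition is_equivalence2 (K : TwoCategory) (A B : underlying K)
    (f : Hom A B) : Prop :=
  exists g : Hom B A,
    @isomorphic (HomC A A) (g ∘ f) (idm A) /\ @isomorphic (HomC B B) (f ∘ g) (idm B).

Definition finite_category (J : Category) : Prop :=
  Finite J /\ forall i j : J, Finite (Hom i j).

Record Cone (J C : Category) (D : Functor J C) := {
  apex :> C;
  leg : forall j, Hom apex (D j);
  leg_nat : forall i j (f : Hom i j), fmap D f ∘ leg i = leg j
}.
Arguments leg {J C D} _ j.

Definition is_limit (J C : Category) (D : Functor J C) (L : Cone D) : Prop :=
  forall K : Cone D, exists! u : Hom K L, forall j, leg L j ∘ u = leg K j.

Record Cocone (J C : Category) (D : Functor J C) := {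
  coapex :> C;
  coleg : forall j, Hom (D j) coapex;
  coleg_nat : forall i j (f : Hom i j), coleg j ∘ fmap D f = coleg i
}.
Arguments coleg {J C D} _ j.

Definition is_colimit (J C : Category) (D : Functor J C) (L : Cocone D) : Prop :=
  forall K : Cocone D,
    exists! u : Hom L K, forall j, u ∘ coleg L j = coleg K j.

Definition finitely_complete (C : Category) : Prop :=
  forall J : Category, finite_category J ->
  forall D : Functor J C, exists L : Cone D, is_limit L.

Definition finitely_cocomplete (C : Category) : Prop :=
  forall J : Category, finite_category J ->
  forall D : Functor J C, exists L : Cocone D, is_colimit L.

Definition is_terminal (C : Category) (a : C) : Prop :=
  forall x : C, exists! u : Hom x a, True.

Definition is_initial (C : Category) (a : C) : Prop :=
  forall x : C, exists! u : Hom a x, True.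

Record is_pullback (C : Category) (a b z p : C) (f : Hom a z) (g : Hom b z)
    (p1 : Hom p a) (p2 : Hom p b) : Prop := {
  pb_comm : f ∘ p1 = g ∘ p2;
  pb_univ : forall x (u : Hom x a) (v : Hom x b), f ∘ u = g ∘ v ->
    exists! w : Hom x p, p1 ∘ w = u /\ p2 ∘ w = v
}.

Definition is_product (C : Category) (a b p : C)
    (p1 : Hom p a) (p2 : Hom p b) : Prop :=
  forall x (u : Hom x a) (v : Hom x b),
    exists! w : Hom x p, p1 ∘ w = u /\ p2 ∘ w = v.

(* The shape [Some true -> None <- Some false]. All hom-sets of this category
   and of the next one have at most one element. *)
Definition cospan_hom (i j : option bool) : Set :=
  match i, j with
  | Some true, Some true | Some false, Some false | _, None => unit
  | _, _ => Empty_set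
  end.

Definition CospanCat : Category.
Proof.
unshelve refine {| Ob := option bool; Hom := cospan_hom |}.
- by move=> [[]|]; exact: tt.
- by move=> [[]|] [[]|] [[]|] [] [].
- by move=> [[]|] [[]|] [].
- by move=> [[]|] [[]|] [].
- by move=> [[]|] [[]|] [[]|] [[]|] [] [] [].
Defined.

Definition pair_hom (i j : bool) : Set :=
  match i, j with
  | true, true | false, false => unit
  | _, _ => Empty_set
  end.

Definition PairCat : Category.
Proof.
unshelve refine {| Ob := bool; Hom := pair_hom |}.
- by move=> []; exact: tt.
- by move=> [] [] [] [] [].
- by move=> [] [] [].
- by move=> [] [] [].
- by move=> [] [] [] [] [] [] [].
Defined.

Lemma Finite_unit : Finite unit.
Proof. by exists (cons tt nil); case; left. Qed.

Lemma Finite_empty : Finite Empty_set.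
Proof. by exists nil; case. Qed.

Lemma finite_CospanCat : finite_category CospanCat.
Proof.
split.
- exists (cons None (cons (Some true) (cons (Some false) nil))).
  by case=> [[]|] /=; tauto.
- by move=> [[]|] [[]|]; (exact: Finite_unit || exact: Finite_empty).
Qed.

Lemma finite_PairCat : finite_category PairCat.
Proof.
split.
- by exists (cons true (cons false nil)); case => /=; tauto.
- by move=> [] []; (exact: Finite_unit || exact: Finite_empty).
Qed.

Definition cospan_diagram (C : Category) (a b z : C) (f : Hom a z)
  (g : Hom b z) : Functor CospanCat C.
Proof.
unshelve refine {| fob := fun i : CospanCat =>
  match i with Some true => a | Some false => b | None => z end |}.
- move=> [[]|] [[]|] [].
  + exact: (idm a).
  + exact: f.
  + exact: (idm b).
  + exact: g.
  + exact: (idm z).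
- by move=> [[]|].
- by move=> [[]|] [[]|] [[]|] [] [] /=; rewrite ?comp_id_l ?comp_id_r.
Defined.

Definition pair_diagram (C : Category) (a b : C) : Functor PairCat C.
Proof.
unshelve refine {| fob := fun i : PairCat => if i then a else b |}.
- move=> [] [] [].
  + exact: (idm a).
  + exact: (idm b).
- by move=> [].
- by move=> [] [] [] [] [] /=; rewrite comp_id_l.
Defined.

Record Pullback (C : Category) (a b z : C) (f : Hom a z) (g : Hom b z) := {
  Pullback_ob : C;
  Pullback_fst : Hom Pullback_ob a;
  Pullback_snd : Hom Pullback_ob b;
  Pullback_spec : is_pullback f g Pullback_fst Pullback_snd
}.

Record Product (C : Category) (a b : C) := {
  Product_ob : C;
  Product_fst : Hom Product_ob a;
  Product_snd : Hom Product_ob b;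
  Product_spec : is_product Product_fst Product_snd
}.

Lemma pullback_exists (C : Category) (HC : finitely_complete C) (a b z : C)
  (f : Hom a z) (g : Hom b z) : inhabited (Pullback f g).
Proof.
have [L HL] := HC _ finite_CospanCat (cospan_diagram f g).
have e1 := @leg_nat _ _ _ L (Some true) None tt.
have e2 := @leg_nat _ _ _ L (Some false) None tt.
pose p1 : Hom L a := leg L (Some true).
pose p2 : Hom L b := leg L (Some false).
constructor; apply: (@Build_Pullback _ _ _ _ f g L p1 p2).
split; first by move: e1 e2 => /= -> ->.
move=> x u v huv.
pose lg (j : CospanCat) : Hom x (cospan_diagram f g j) :=
  match j with Some true => u | Some false => v | None => f ∘ u end.
have lg_nat : forall i j (h : Hom i j),
    fmap (cospan_diagram f g) h ∘ lg i = lg j.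
  by move=> [[]|] [[]|] [] /=; rewrite ?comp_id_l.
have [w [hw uw]] := HL (Build_Cone lg_nat).
exists w; split; first by split; [exact: (hw (Some true))|exact: (hw (Some false))].
move=> w' [h1 h2]; apply: uw => -[[]|] //=.
by move: e1 => /= <-; rewrite -comp_assoc h1.
Qed.

Lemma product_exists (C : Category) (HC : finitely_complete C) (a b : C) :
  inhabited (Product a b).
Proof.
have [L HL] := HC _ finite_PairCat (pair_diagram a b).
pose p1 : Hom L a := leg L true.
pose p2 : Hom L b := leg L false.
constructor; apply: (@Build_Product _ _ _ L p1 p2) => x u v.
pose lg (j : PairCat) : Hom x (pair_diagram a b j) :=
  match j with true => u | false => v end.
have lg_nat : forall i j (h : Hom i j), fmap (pair_diagram a b) h ∘ lg i = lg j.
  by move=> [] [] [] /=; rewrite ?comp_id_l.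
have [w [hw uw]] := HL (Build_Cone lg_nat).
exists w; split; first by split; [exact: (hw true)|exact: (hw false)].
by move=> w' [h1 h2]; apply: uw => -[].
Qed.

Section ChosenLimits.
Variables (C : Category) (HC : finitely_complete C).

Section PB.
Variables (a b z : C) (f : Hom a z) (g : Hom b z).

Definition chosen_pb : Pullback f g :=
  epsilon (pullback_exists HC f g) (fun _ => True).
Definition pb : C := Pullback_ob chosen_pb.
Definition pb_fst : Hom pb a := Pullback_fst chosen_pb.
Definition pb_snd : Hom pb b := Pullback_snd chosen_pb.
Lemma pb_spec : is_pullback f g pb_fst pb_snd.
Proof. exact: Pullback_spec. Qed.

Definition pb_pair (x : C) (u : Hom x a) (v : Hom x b) (H : f ∘ u = g ∘ v) :
  Hom x pb :=
  proj1_sig (constructive_indefinite_description _ (pb_univ pb_spec H)).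

Lemma pb_square : f ∘ pb_fst = g ∘ pb_snd.
Proof. exact: pb_comm pb_spec. Qed.

Lemma pb_pair_fst (x : C) (u : Hom x a) (v : Hom x b) (H : f ∘ u = g ∘ v) :
  pb_fst ∘ pb_pair H = u.
Proof.
by rewrite /pb_pair; case: constructive_indefinite_description => w [[]].
Qed.

Lemma pb_pair_snd (x : C) (u : Hom x a) (v : Hom x b) (H : f ∘ u = g ∘ v) :
  pb_snd ∘ pb_pair H = v.
Proof.
by rewrite /pb_pair; case: constructive_indefinite_description => w [[]].
Qed.

Lemma pb_ext (x : C) (u v : Hom x pb) :
  pb_fst ∘ u = pb_fst ∘ v -> pb_snd ∘ u = pb_snd ∘ v -> u = v.
Proof.
move=> h1 h2.
have H : f ∘ (pb_fst ∘ v) = g ∘ (pb_snd ∘ v).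
  by rewrite !comp_assoc pb_square.
have [w [_ uw]] := pb_univ pb_spec H.
by rewrite -(uw u) // -(uw v).
Qed.
End PB.

Section PROD.
Variables (a b : C).

Definition chosen_prod : Product a b :=
  epsilon (product_exists HC a b) (fun _ => True).
Definition prd : C := Product_ob chosen_prod.
Definition prd_fst : Hom prd a := Product_fst chosen_prod.
Definition prd_snd : Hom prd b := Product_snd chosen_prod.
Lemma prd_spec : is_product prd_fst prd_snd.
Proof. exact: Product_spec. Qed.

Definition prd_pair (x : C) (u : Hom x a) (v : Hom x b) : Hom x prd :=
  proj1_sig (constructive_indefinite_description _ (prd_spec u v)).

Lemma prd_pair_fst (x : C) (u : Hom x a) (v : Hom x b) :
  prd_fst ∘ prd_pair u v = u.
Proof.
by rewrite /prd_pair; case: constructive_indefinite_description => w [[]].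
Qed.

Lemma prd_pair_snd (x : C) (u : Hom x a) (v : Hom x b) :
  prd_snd ∘ prd_pair u v = v.
Proof.
by rewrite /prd_pair; case: constructive_indefinite_description => w [[]].
Qed.

Lemma prd_ext (x : C) (u v : Hom x prd) :
  prd_fst ∘ u = prd_fst ∘ v -> prd_snd ∘ u = prd_snd ∘ v -> u = v.
Proof.
move=> h1 h2.
have [w [_ uw]] := prd_spec (prd_fst ∘ v) (prd_snd ∘ v).
by rewrite -(uw u) // -(uw v).
Qed.
End PROD.

Definition prd_map (a b a' b' : C) (f : Hom a a') (g : Hom b b') :
  Hom (prd a b) (prd a' b') :=
  prd_pair (f ∘ prd_fst a b) (g ∘ prd_snd a b).

(* Domains of definition of the two composites in the unit and associativity
   laws below; composition is written in diagrammatic order, so a composable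
   pair is a pair (f, g) with t f = s g. *)
Section Composability.
Variables (b0 b1 : C) (s t : Hom b1 b0) (e : Hom b0 b1) (m : Hom (pb t s) b1).

Lemma unit_l_ok : t ∘ e = idm b0 -> t ∘ (e ∘ s) = s ∘ idm b1.
Proof. by move=> te; rewrite comp_assoc te comp_id_l comp_id_r. Qed.

Lemma unit_r_ok : s ∘ e = idm b0 -> t ∘ idm b1 = s ∘ (e ∘ t).
Proof. by move=> se; rewrite comp_assoc se comp_id_l comp_id_r. Qed.

(* [pb (pb_snd t s) (pb_fst t s)] is the object of composable triples. *)
Notation p12 := (pb_fst (pb_snd t s) (pb_fst t s)).
Notation p23 := (pb_snd (pb_snd t s) (pb_fst t s)).

Lemma assoc_l_ok : t ∘ m = t ∘ pb_snd t s ->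
  t ∘ (m ∘ p12) = s ∘ (pb_snd t s ∘ p23).
Proof.
move=> tm; rewrite comp_assoc tm -comp_assoc pb_square !comp_assoc.
by rewrite pb_square.
Qed.

Lemma assoc_r_ok : s ∘ m = s ∘ pb_fst t s ->
  t ∘ (pb_fst t s ∘ p12) = s ∘ (m ∘ p23).
Proof.
move=> sm; rewrite comp_assoc pb_square (comp_assoc s m) sm -!comp_assoc.
by rewrite pb_square.
Qed.
End Composability.

Record IntCat := {
  obs : C;
  mors : C;
  src : Hom mors obs;
  tgt : Hom mors obs;
  idn : Hom obs mors;
  mul : Hom (pb tgt src) mors;
  src_idn : src ∘ idn = idm obs;
  tgt_idn : tgt ∘ idn = idm obs;
  src_mul : src ∘ mul = src ∘ pb_fst tgt src;
  tgt_mul : tgt ∘ mul = tgt ∘ pb_snd tgt src;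
  mul_unit_l : mul ∘ pb_pair (unit_l_ok src tgt_idn) = idm mors;
  mul_unit_r : mul ∘ pb_pair (unit_r_ok tgt src_idn) = idm mors;
  mul_assoc : mul ∘ pb_pair (assoc_l_ok tgt_mul) =
              mul ∘ pb_pair (assoc_r_ok src_mul)
}.

Definition icmp (B : IntCat) (x : C) (f g : Hom x (mors B))
    (H : tgt B ∘ f = src B ∘ g) : Hom x (mors B) :=
  mul B ∘ pb_pair H.

Lemma fun_mul_ok (A B : IntCat) (f0 : Hom (obs A) (obs B))
    (f1 : Hom (mors A) (mors B)) :
  src B ∘ f1 = f0 ∘ src A -> tgt B ∘ f1 = f0 ∘ tgt A ->
  tgt B ∘ (f1 ∘ pb_fst (tgt A) (src A)) = src B ∘ (f1 ∘ pb_snd (tgt A) (src A)).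
Proof.
by move=> hs ht; rewrite !comp_assoc hs ht -!comp_assoc pb_square.
Qed.

Record IntFun (A B : IntCat) := {
  fun0 : Hom (obs A) (obs B);
  fun1 : Hom (mors A) (mors B);
  fun_src : src B ∘ fun1 = fun0 ∘ src A;
  fun_tgt : tgt B ∘ fun1 = fun0 ∘ tgt A;
  fun_idn : fun1 ∘ idn A = idn B ∘ fun0;
  fun_mul : fun1 ∘ mul A = mul B ∘ pb_pair (fun_mul_ok fun_src fun_tgt)
}.

Lemma nat_l_ok (A B : IntCat) (F : IntFun A B) (al : Hom (obs A) (mors B)) :
  src B ∘ al = fun0 F -> tgt B ∘ fun1 F = src B ∘ (al ∘ tgt A).
Proof. by move=> h; rewrite fun_tgt comp_assoc h. Qed.

Lemma nat_r_ok (A B : IntCat) (G : IntFun A B) (al : Hom (obs A) (mors B)) :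
  tgt B ∘ al = fun0 G -> tgt B ∘ (al ∘ src A) = src B ∘ fun1 G.
Proof. by move=> h; rewrite fun_src comp_assoc h. Qed.

Record IntNat (A B : IntCat) (F G : IntFun A B) := {
  nt : Hom (obs A) (mors B);
  nt_src : src B ∘ nt = fun0 F;
  nt_tgt : tgt B ∘ nt = fun0 G;
  nt_nat : icmp (nat_l_ok nt_src) = icmp (nat_r_ok nt_tgt)
}.

Lemma IntFun_eq (A B : IntCat) (F G : IntFun A B) :
  fun0 F = fun0 G -> fun1 F = fun1 G -> F = G.
Proof.
case: F G => [f0 f1 a b c d] [g0 g1 a' b' c' d'] /= e0 e1.
move: a' b' c' d'; case: _ / e0; case: _ / e1 => a' b' c' d'.
move: d d'; rewrite (proof_irrelevance _ a a') (proof_irrelevance _ b b') => d d'.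
by rewrite (proof_irrelevance _ c c') (proof_irrelevance _ d d').
Qed.

Lemma IntNat_eq (A B : IntCat) (F G : IntFun A B) (al be : IntNat F G) :
  nt al = nt be -> al = be.
Proof.
case: al be => [f a b c] [g a' b' c'] /= e.
move: a' b' c'; case: _ / e => a' b' c'.
move: c c'; rewrite (proof_irrelevance _ a a') (proof_irrelevance _ b b') => c c'.
by rewrite (proof_irrelevance _ c c').
Qed.

(* [ct f g] is the composite [icmp] of f and g when t f = s g; its value is
   irrelevant otherwise. It is only used in proofs. *)
Definition ct (B : IntCat) (x : C) (f g : Hom x (mors B)) : Hom x (mors B) :=
  match excluded_middle_informative (tgt B ∘ f = src B ∘ g) with
  | left H => icmp H
  | right _ => f
  end.

Section Calculus.
Variable B : IntCat.

Lemma icmpE (x : C) (f g : Hom x (mors B)) (H : tgt B ∘ f = src B ∘ g) :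
  icmp H = ct f g.
Proof.
rewrite /ct; case: excluded_middle_informative => // H'.
by rewrite (proof_irrelevance _ H H').
Qed.

Lemma src_ct (x : C) (f g : Hom x (mors B)) : tgt B ∘ f = src B ∘ g ->
  src B ∘ ct f g = src B ∘ f.
Proof.
by move=> H; rewrite -(icmpE H) /icmp comp_assoc src_mul -comp_assoc pb_pair_fst.
Qed.

Lemma tgt_ct (x : C) (f g : Hom x (mors B)) : tgt B ∘ f = src B ∘ g ->
  tgt B ∘ ct f g = tgt B ∘ g.
Proof.
by move=> H; rewrite -(icmpE H) /icmp comp_assoc tgt_mul -comp_assoc pb_pair_snd.
Qed.

Lemma ct_pre (x y : C) (f g : Hom x (mors B)) (u : Hom y x) :
  tgt B ∘ f = src B ∘ g -> ct f g ∘ u = ct (f ∘ u) (g ∘ u).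
Proof.
move=> H; have H' : tgt B ∘ (f ∘ u) = src B ∘ (g ∘ u) by rewrite !comp_assoc H.
rewrite -(icmpE H) -(icmpE H') /icmp -comp_assoc; congr comp.
by apply: pb_ext; rewrite comp_assoc ?pb_pair_fst ?pb_pair_snd.
Qed.

Lemma ct_id_l (x : C) (f : Hom x (mors B)) (a : Hom x (obs B)) :
  a = src B ∘ f -> ct (idn B ∘ a) f = f.
Proof.
move=> ->; have := mul_unit_l B; rewrite -/(icmp _) icmpE => h.
rewrite -{3}(comp_id_l f) -h ct_pre ?comp_id_l ?comp_assoc //.
by rewrite tgt_idn comp_id_l comp_id_r.
Qed.

Lemma ct_id_r (x : C) (f : Hom x (mors B)) (a : Hom x (obs B)) :
  a = tgt B ∘ f -> ct f (idn B ∘ a) = f.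
Proof.
move=> ->; have := mul_unit_r B; rewrite -/(icmp _) icmpE => h.
rewrite -{3}(comp_id_l f) -h ct_pre ?comp_id_l ?comp_assoc //.
by rewrite src_idn comp_id_l comp_id_r.
Qed.

Lemma ct_assoc (x : C) (f g h : Hom x (mors B)) :
  tgt B ∘ f = src B ∘ g -> tgt B ∘ g = src B ∘ h ->
  ct (ct f g) h = ct f (ct g h).
Proof.
move=> H1 H2.
have H : pb_snd (tgt B) (src B) ∘ pb_pair H1
       = pb_fst (tgt B) (src B) ∘ pb_pair H2.
  by rewrite pb_pair_fst pb_pair_snd.
have := f_equal (fun k => k ∘ pb_pair H) (mul_assoc B).
rewrite -!/(icmp _) !icmpE (ct_pre _ (assoc_l_ok (tgt_mul B))).
rewrite (ct_pre _ (assoc_r_ok (src_mul B))).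
rewrite -!comp_assoc !pb_pair_fst !pb_pair_snd.
by rewrite -!/(icmp _) !icmpE.
Qed.
End Calculus.

Lemma fun_ct (A B : IntCat) (F : IntFun A B) (x : C) (f g : Hom x (mors A)) :
  tgt A ∘ f = src A ∘ g -> fun1 F ∘ ct f g = ct (fun1 F ∘ f) (fun1 F ∘ g).
Proof.
move=> H; rewrite -(icmpE H) /icmp comp_assoc fun_mul -/(icmp _) icmpE.
rewrite ct_pre; first exact: fun_mul_ok (fun_src F) (fun_tgt F).
by rewrite -!comp_assoc pb_pair_fst pb_pair_snd.
Qed.

Lemma fun_composable (A B : IntCat) (F : IntFun A B) (x : C)
  (f g : Hom x (mors A)) : tgt A ∘ f = src A ∘ g ->
  tgt B ∘ (fun1 F ∘ f) = src B ∘ (fun1 F ∘ g).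
Proof.
by move=> H; rewrite !comp_assoc fun_src fun_tgt -!comp_assoc H.
Qed.

Lemma nt_ct (A B : IntCat) (F G : IntFun A B) (al : IntNat F G) (x : C)
  (f : Hom x (mors A)) (a b : Hom x (obs A)) :
  a = src A ∘ f -> b = tgt A ∘ f ->
  ct (fun1 F ∘ f) (nt al ∘ b) = ct (nt al ∘ a) (fun1 G ∘ f).
Proof.
move=> -> ->; have := nt_nat al; rewrite !icmpE => /(f_equal (fun k => k ∘ f)).
rewrite (ct_pre _ (nat_l_ok (nt_src al))) (ct_pre _ (nat_r_ok (nt_tgt al))).
by rewrite -!comp_assoc.
Qed.

Lemma nt_ct1 (A B : IntCat) (F G : IntFun A B) (al : IntNat F G) :
  ct (fun1 F) (nt al ∘ tgt A) = ct (nt al ∘ src A) (fun1 G).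
Proof. by have := nt_nat al; rewrite !icmpE. Qed.

Lemma mulE (A : IntCat) : mul A = ct (pb_fst _ _) (pb_snd _ _).
Proof.
rewrite -(icmpE (pb_square (tgt A) (src A))) /icmp -{1}(comp_id_r (mul A)).
by congr comp; apply: pb_ext; rewrite ?pb_pair_fst ?pb_pair_snd comp_id_r.
Qed.

Lemma mul_pre (A : IntCat) (x : C) (u : Hom x (pb (tgt A) (src A))) :
  mul A ∘ u = ct (pb_fst _ _ ∘ u) (pb_snd _ _ ∘ u).
Proof. by rewrite {1}mulE ct_pre; first exact: pb_square. Qed.

Definition IntFun_mk (A B : IntCat) (f0 : Hom (obs A) (obs B))
    (f1 : Hom (mors A) (mors B)) (hs : src B ∘ f1 = f0 ∘ src A)
    (ht : tgt B ∘ f1 = f0 ∘ tgt A) (hi : f1 ∘ idn A = idn B ∘ f0)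
    (hm : f1 ∘ mul A = ct (f1 ∘ pb_fst _ _) (f1 ∘ pb_snd _ _)) : IntFun A B.
Proof.
refine {| fun_src := hs; fun_tgt := ht; fun_idn := hi; fun_mul := _ |}.
by rewrite hm -/(icmp _) icmpE.
Defined.

Definition IntNat_mk (A B : IntCat) (F G : IntFun A B)
    (al : Hom (obs A) (mors B)) (hs : src B ∘ al = fun0 F)
    (ht : tgt B ∘ al = fun0 G)
    (hn : ct (fun1 F) (al ∘ tgt A) = ct (al ∘ src A) (fun1 G)) : IntNat F G.
Proof.
refine {| nt_src := hs; nt_tgt := ht; nt_nat := _ |}.
by rewrite !icmpE.
Defined.

Definition IntFun_id (A : IntCat) : IntFun A A.
Proof.
apply: (@IntFun_mk A A (idm _) (idm _)).
1,2,3: by rewrite comp_id_l comp_id_r.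
by rewrite !comp_id_l -mulE.
Defined.

Definition IntFun_comp (A B D : IntCat) (G : IntFun B D) (F : IntFun A B) :
  IntFun A D.
Proof.
apply: (@IntFun_mk A D (fun0 G ∘ fun0 F) (fun1 G ∘ fun1 F)).
- by rewrite comp_assoc fun_src -!comp_assoc fun_src.
- by rewrite comp_assoc fun_tgt -!comp_assoc fun_tgt.
- by rewrite -comp_assoc fun_idn !comp_assoc fun_idn.
- rewrite -!comp_assoc mulE !fun_ct ?pb_square //.
  exact: fun_mul_ok (fun_src F) (fun_tgt F).
Defined.

Definition IntNat_id (A B : IntCat) (F : IntFun A B) : IntNat F F.
Proof.
apply: (@IntNat_mk A B F F (idn B ∘ fun0 F)).
- by rewrite comp_assoc src_idn comp_id_l.
- by rewrite comp_assoc tgt_idn comp_id_l.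
- by rewrite -!comp_assoc ct_id_l ?ct_id_r ?fun_src ?fun_tgt.
Defined.

Lemma nt_ok (A B : IntCat) (F G H : IntFun A B)
  (be : IntNat G H) (al : IntNat F G) : tgt B ∘ nt al = src B ∘ nt be.
Proof. by rewrite nt_src nt_tgt. Qed.

Definition IntNat_comp (A B : IntCat) (F G H : IntFun A B)
  (be : IntNat G H) (al : IntNat F G) : IntNat F H.
Proof.
apply: (@IntNat_mk A B F H (icmp (nt_ok be al))).
- by rewrite icmpE (src_ct (nt_ok be al)) ?nt_src.
- by rewrite icmpE (tgt_ct (nt_ok be al)) ?nt_tgt.
- have ok := nt_ok be al.
  have l1 := nat_l_ok (nt_src al); have l2 := nat_r_ok (nt_tgt al).
  have l3 := nat_l_ok (nt_src be); have l4 := nat_r_ok (nt_tgt be).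
  have okt : tgt B ∘ (nt al ∘ tgt A) = src B ∘ (nt be ∘ tgt A).
    by rewrite !comp_assoc ok.
  have oks : tgt B ∘ (nt al ∘ src A) = src B ∘ (nt be ∘ src A).
    by rewrite !comp_assoc ok.
  rewrite icmpE !ct_pre // -ct_assoc // nt_ct1 ct_assoc // nt_ct1.
  by rewrite ct_assoc.
Defined.

Definition HomCat (A B : IntCat) : Category.
Proof.
exists (IntFun A B) (@IntNat A B) (@IntNat_id A B) (@IntNat_comp A B).
- move=> F G al; apply: IntNat_eq; rewrite /= icmpE ct_id_r //.
  by rewrite nt_tgt.
- move=> F G al; apply: IntNat_eq; rewrite /= icmpE ct_id_l //.
  by rewrite nt_src.
- move=> F G H K ga be al; apply: IntNat_eq.
  by rewrite /= !icmpE ct_assoc // nt_src nt_tgt.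
Defined.

Lemma hcomp_ok (A B D : IntCat) (F F' : IntFun A B) (G G' : IntFun B D)
  (be : IntNat G G') (al : IntNat F F') :
  tgt D ∘ (fun1 G ∘ nt al) = src D ∘ (nt be ∘ fun0 F').
Proof. by rewrite !comp_assoc fun_tgt nt_src -comp_assoc nt_tgt. Qed.

(* Horizontal composite: at a it is  GFa --> GF'a --> G'F'a. *)
Definition IntNat_hcomp (A B D : IntCat) (F F' : IntFun A B) (G G' : IntFun B D)
  (be : IntNat G G') (al : IntNat F F') :
  IntNat (IntFun_comp G F) (IntFun_comp G' F').
Proof.
apply: (@IntNat_mk A D _ _ (icmp (hcomp_ok be al))).
- by rewrite icmpE (src_ct (hcomp_ok be al)) comp_assoc fun_src -comp_assoc nt_src.
- by rewrite icmpE (tgt_ct (hcomp_ok be al)) comp_assoc nt_tgt.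
- have ok := hcomp_ok be al.
  have okt : tgt D ∘ (fun1 G ∘ nt al ∘ tgt A) =
             src D ∘ (nt be ∘ fun0 F' ∘ tgt A).
    by rewrite (comp_assoc (tgt D)) ok -!comp_assoc.
  have oks : tgt D ∘ (fun1 G ∘ nt al ∘ src A) =
             src D ∘ (nt be ∘ fun0 F' ∘ src A).
    by rewrite (comp_assoc (tgt D)) ok -!comp_assoc.
  have l1 := nat_l_ok (nt_src al); have l2 := nat_r_ok (nt_tgt al).
  have l3 := fun_composable G l1; have l4 := fun_composable G l2.
  have l5 : tgt D ∘ (fun1 G ∘ fun1 F') = src D ∘ (nt be ∘ fun0 F' ∘ tgt A).
    by rewrite !comp_assoc fun_tgt nt_src -!comp_assoc fun_tgt.
  have l6 : tgt D ∘ (nt be ∘ fun0 F' ∘ src A) = src D ∘ (fun1 G' ∘ fun1 F').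
    by rewrite !comp_assoc fun_src nt_tgt -!comp_assoc fun_src.
  have e1 : ct (fun1 G ∘ fun1 F) (fun1 G ∘ nt al ∘ tgt A) =
            ct (fun1 G ∘ nt al ∘ src A) (fun1 G ∘ fun1 F').
    by rewrite -!comp_assoc -!fun_ct // nt_ct1.
  have e2 : ct (fun1 G ∘ fun1 F') (nt be ∘ fun0 F' ∘ tgt A) =
            ct (nt be ∘ fun0 F' ∘ src A) (fun1 G' ∘ fun1 F').
    rewrite -!comp_assoc; apply: nt_ct; by rewrite ?fun_src ?fun_tgt.
  rewrite !comp_assoc in l3 l4.
  rewrite icmpE !ct_pre //= -ct_assoc //; first by rewrite !comp_assoc.
  rewrite e1 ct_assoc //; first by rewrite !comp_assoc.
  by rewrite e2 ct_assoc.
Defined.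

Definition IntHcomp (A B D : IntCat) :
  Functor (ProdCat (HomCat B D) (HomCat A B)) (HomCat A D).
Proof.
unshelve refine {| fob := fun p : ProdCat (HomCat B D) (HomCat A B) =>
    IntFun_comp (fst p) (snd p) : HomCat A D;
  fmap := fun p q be => IntNat_hcomp (fst be) (snd be) |}.
- move=> [G F]; apply: IntNat_eq; rewrite /= icmpE -(comp_assoc (idn D)) ct_id_r.
  + by rewrite !comp_assoc fun_tgt -(comp_assoc _ (tgt B)) tgt_idn comp_id_r.
  + by rewrite comp_assoc fun_idn -comp_assoc.
- move=> [G F] [G' F'] [G'' F''] [be' al'] [be al]; apply: IntNat_eq => /=.
  rewrite !icmpE (fun_ct _ (nt_ok al' al)) (ct_pre _ (nt_ok be' be)).
  have o1 : tgt D ∘ (fun1 G ∘ nt al) = src D ∘ (fun1 G ∘ nt al').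
    exact: (fun_composable G (nt_ok al' al)).
  have o2 : tgt D ∘ (nt be ∘ fun0 F'') = src D ∘ (nt be' ∘ fun0 F'').
    by rewrite !comp_assoc (nt_ok be' be).
  have o3 := hcomp_ok be al; have o4 := hcomp_ok be' al'.
  have o5 := hcomp_ok be al'.
  have o6 : tgt D ∘ (nt be ∘ fun0 F') = src D ∘ (fun1 G' ∘ nt al').
    by rewrite !comp_assoc fun_src nt_tgt -comp_assoc nt_src.
  rewrite !ct_assoc ?src_ct ?tgt_ct //; congr ct.
  rewrite -!ct_assoc //; congr ct.
  by apply: nt_ct; rewrite ?nt_src ?nt_tgt.
Defined.

Lemma HomCat_functor_eq (X : Category) (A B : IntCat)
  (F G : Functor X (HomCat A B)) :
  (forall x, F x = G x) ->
  (forall x y (f : Hom x y), nt (fmap F f) = nt (fmap G f)) -> F = G.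
Proof.
case: F G => [Fo Fm Fi Fc] [Go Gm Gi Gc] /= eo em.
have e : Fo = Go by apply: functional_extensionality.
case: _ / e Gm Gi Gc em {eo} => Gm Gi Gc em.
have e : Fm = Gm.
  do 3 (apply: functional_extensionality_dep => ?); exact: IntNat_eq.
case: _ / e Gi Gc {em} => Gi Gc.
by rewrite (proof_irrelevance _ Fi Gi) (proof_irrelevance _ Fc Gc).
Qed.

Definition CatC : TwoCategory.
Proof.
unshelve refine {| cell0 := IntCat; HomC := HomCat; one := IntFun_id;
  hcomp := IntHcomp |}.
- move=> A B; apply: HomCat_functor_eq => [F|F G al] /=.
    by apply: IntFun_eq; rewrite /= comp_id_l.
  rewrite icmpE comp_id_l comp_id_r ct_id_r // nt_tgt //.
- move=> A B; apply: HomCat_functor_eq => [F|F G al] /=.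
    by apply: IntFun_eq; rewrite /= comp_id_r.
  rewrite icmpE !comp_id_r fun_idn ct_id_l // nt_src //.
- move=> A B D E; apply: HomCat_functor_eq => [[H [G F]]|].
    by apply: IntFun_eq; rewrite /= !comp_assoc.
  move=> [H [G F]] [H' [G' F']] [ga [be al]] /=.
  rewrite !icmpE (fun_ct _ (hcomp_ok be al)) (ct_pre _ (hcomp_ok ga be)).
  rewrite ct_assoc.
  + exact: (fun_composable H (hcomp_ok be al)).
  + have := f_equal (fun k => k ∘ fun0 F') (hcomp_ok ga be).
    by rewrite /= -!comp_assoc.
  + by rewrite -!comp_assoc.
Defined.

(* A generalized element x of the object of morphisms is an internal
   isomorphism when it has a two-sided inverse y. *)
Definition internal_iso (B : IntCat) (z : C) (x : Hom z (mors B)) : Prop :=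
  exists (y : Hom z (mors B)) (H : tgt B ∘ x = src B ∘ y)
         (H' : tgt B ∘ y = src B ∘ x),
    icmp H = idn B ∘ (src B ∘ x) /\ icmp H' = idn B ∘ (tgt B ∘ x).

Definition is_groupoid (B : IntCat) : Prop := internal_iso (idm (mors B)).

Lemma internal_isoP (B : IntCat) (z : C) (x : Hom z (mors B)) :
  internal_iso x <-> exists y, [/\ tgt B ∘ x = src B ∘ y,
    tgt B ∘ y = src B ∘ x, ct x y = idn B ∘ (src B ∘ x) &
    ct y x = idn B ∘ (tgt B ∘ x)].
Proof.
split; first by move=> [y [H [H' []]]]; rewrite !icmpE; exists y.
by move=> [y [H H' e e']]; exists y, H, H'; rewrite !icmpE.
Qed.

Lemma internal_iso_pre (B : IntCat) (z w : C) (x : Hom z (mors B))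
  (u : Hom w z) : internal_iso x -> internal_iso (x ∘ u).
Proof.
move=> /internal_isoP[y [H H' e e']]; apply/internal_isoP; exists (y ∘ u).
by split; rewrite -?ct_pre // ?e ?e' !comp_assoc ?H ?H'.
Qed.

Lemma internal_iso_fun (A B : IntCat) (F : IntFun A B) (z : C)
  (x : Hom z (mors A)) : internal_iso x -> internal_iso (fun1 F ∘ x).
Proof.
move=> /internal_isoP[y [H H' e e']]; apply/internal_isoP.
exists (fun1 F ∘ y); split; try exact: fun_composable.
- by rewrite -fun_ct // e comp_assoc fun_idn (comp_assoc (src B)) fun_src -!comp_assoc.
- by rewrite -fun_ct // e' comp_assoc fun_idn (comp_assoc (tgt B)) fun_tgt -!comp_assoc.
Qed.

Lemma internal_iso_idn (B : IntCat) (z : C) (a : Hom z (obs B)) :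
  internal_iso (idn B ∘ a).
Proof.
apply/internal_isoP; exists (idn B ∘ a).
have es : src B ∘ (idn B ∘ a) = a by rewrite comp_assoc src_idn comp_id_l.
have et : tgt B ∘ (idn B ∘ a) = a by rewrite comp_assoc tgt_idn comp_id_l.
by split; rewrite ?es ?et // ct_id_l ?es.
Qed.

Lemma internal_iso_ct (B : IntCat) (z : C) (f g : Hom z (mors B)) :
  tgt B ∘ f = src B ∘ g -> internal_iso f -> internal_iso g ->
  internal_iso (ct f g).
Proof.
move=> H /internal_isoP[f' [H1 H2 e1 e2]] /internal_isoP[g' [H3 H4 e3 e4]].
have H5 : tgt B ∘ g' = src B ∘ f' by rewrite H4 -H.
apply/internal_isoP; exists (ct g' f'); split; rewrite ?src_ct ?tgt_ct //.
- rewrite ct_assoc ?src_ct // -(ct_assoc H3 H5) e3 ct_id_l ?e1 //.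
  by rewrite -H.
- rewrite ct_assoc ?src_ct // -(ct_assoc H2 H) e2 ct_id_l ?e4 //.
Qed.

Lemma inverse_unique (B : IntCat) (z : C) (x y y' : Hom z (mors B)) :
  tgt B ∘ x = src B ∘ y -> tgt B ∘ y = src B ∘ x ->
  tgt B ∘ x = src B ∘ y' -> tgt B ∘ y' = src B ∘ x ->
  ct y x = idn B ∘ (tgt B ∘ x) -> ct x y' = idn B ∘ (src B ∘ x) -> y = y'.
Proof.
move=> H1 H2 H3 H4 e1 e2.
by rewrite -(@ct_id_r B z y (src B ∘ x)) // -e2 -ct_assoc // e1 ct_id_l.
Qed.

Section IsoObject.
Variable B : IntCat.

(* Pairs (f, g) of composable morphisms whose composite is an identity. *)
Definition sec_pairs : C := pb (mul B) (idn B).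
Definition sec1 : Hom sec_pairs (mors B) :=
  pb_fst (tgt B) (src B) ∘ pb_fst (mul B) (idn B).
Definition sec2 : Hom sec_pairs (mors B) :=
  pb_snd (tgt B) (src B) ∘ pb_fst (mul B) (idn B).

(* Pairs (f, g) such that both (f, g) and (g, f) are in [sec_pairs]. *)
Definition iso_mors : C := pb (prd_pair sec1 sec2) (prd_pair sec2 sec1).
Definition iso_inc : Hom iso_mors (mors B) :=
  sec1 ∘ pb_fst (prd_pair sec1 sec2) (prd_pair sec2 sec1).

Lemma sec_composable : tgt B ∘ sec1 = src B ∘ sec2.
Proof. by rewrite /sec1 /sec2 !comp_assoc pb_square. Qed.

Lemma sec_ct : ct sec1 sec2 = idn B ∘ (src B ∘ sec1).
Proof.
have e : ct sec1 sec2 = idn B ∘ pb_snd (mul B) (idn B).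
  by rewrite -pb_square mul_pre.
rewrite e; congr comp.
rewrite -(src_ct sec_composable) e comp_assoc src_idn comp_id_l //.
Qed.

Lemma sec_ext (z : C) (u v : Hom z sec_pairs) :
  sec1 ∘ u = sec1 ∘ v -> sec2 ∘ u = sec2 ∘ v -> u = v.
Proof.
move=> e1 e2.
have e : pb_fst (mul B) (idn B) ∘ u = pb_fst (mul B) (idn B) ∘ v.
  by apply: pb_ext; rewrite !comp_assoc.
apply: pb_ext => //.
have h w : pb_snd (mul B) (idn B) ∘ w
         = src B ∘ (mul B ∘ (pb_fst (mul B) (idn B) ∘ w)) :> Hom z _.
  by rewrite (comp_assoc (mul B)) pb_square !comp_assoc src_idn comp_id_l.
by rewrite !h e.
Qed.

Lemma sec_lift (z : C) (x y : Hom z (mors B)) :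
  tgt B ∘ x = src B ∘ y -> ct x y = idn B ∘ (src B ∘ x) ->
  exists u : Hom z sec_pairs, sec1 ∘ u = x /\ sec2 ∘ u = y.
Proof.
move=> H; rewrite -(icmpE H) => e; exists (pb_pair e).
by rewrite /sec1 /sec2 -!comp_assoc pb_pair_fst pb_pair_fst pb_pair_snd.
Qed.

Notation q1 := (pb_fst (prd_pair sec1 sec2) (prd_pair sec2 sec1)).
Notation q2 := (pb_snd (prd_pair sec1 sec2) (prd_pair sec2 sec1)).

Lemma iso_mors_swap : sec1 ∘ q1 = sec2 ∘ q2 /\ sec2 ∘ q1 = sec1 ∘ q2.
Proof.
have h := pb_square (prd_pair sec1 sec2) (prd_pair sec2 sec1); split.
- have := f_equal (fun k => prd_fst _ _ ∘ k) h.
  by rewrite !comp_assoc !prd_pair_fst.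
- have := f_equal (fun k => prd_snd _ _ ∘ k) h.
  by rewrite !comp_assoc !prd_pair_snd.
Qed.

Lemma iso_inc_laws : [/\ tgt B ∘ iso_inc = src B ∘ (sec2 ∘ q1),
  tgt B ∘ (sec2 ∘ q1) = src B ∘ iso_inc,
  ct iso_inc (sec2 ∘ q1) = idn B ∘ (src B ∘ iso_inc) &
  ct (sec2 ∘ q1) iso_inc = idn B ∘ (tgt B ∘ iso_inc)].
Proof.
have [h1 h2] := iso_mors_swap; have h := sec_composable; have hc := sec_ct.
have c1 : tgt B ∘ iso_inc = src B ∘ (sec2 ∘ q1).
  by rewrite /iso_inc (comp_assoc (tgt B)) h -comp_assoc.
have c2 : tgt B ∘ (sec2 ∘ q1) = src B ∘ iso_inc.
  by rewrite /iso_inc h1 h2 (comp_assoc (tgt B)) h -comp_assoc.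
split=> //.
- by rewrite /iso_inc -(ct_pre _ h) hc -!comp_assoc.
- by rewrite c1 /iso_inc h1 h2 -(ct_pre _ h) hc -!comp_assoc.
Qed.

Lemma iso_inc_iso : internal_iso iso_inc.
Proof. by apply/internal_isoP; exists (sec2 ∘ q1); exact: iso_inc_laws. Qed.

Lemma iso_inc_mono (z : C) (u v : Hom z iso_mors) :
  iso_inc ∘ u = iso_inc ∘ v -> u = v.
Proof.
move=> e; have [h1 h2] := iso_mors_swap; have [l1 l2 l3 l4] := iso_inc_laws.
have e' : sec2 ∘ q1 ∘ u = sec2 ∘ q1 ∘ v.
{ have k1 w : tgt B ∘ (iso_inc ∘ w) = src B ∘ (sec2 ∘ q1 ∘ w) :> Hom z _.
    by rewrite (comp_assoc (tgt B)) l1 -!comp_assoc.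
  have k2 w : tgt B ∘ (sec2 ∘ q1 ∘ w) = src B ∘ (iso_inc ∘ w) :> Hom z _.
    by rewrite (comp_assoc (tgt B)) l2 -!comp_assoc.
  apply: (@inverse_unique B z (iso_inc ∘ u)).
  - exact: k1.
  - exact: k2.
  - rewrite e; exact: k1.
  - rewrite e; exact: k2.
  - by rewrite -(ct_pre _ l2) l4 -!comp_assoc.
  - by rewrite e -(ct_pre _ l1) l3 -!comp_assoc. }
have e1 : q1 ∘ u = q1 ∘ v.
{ apply: sec_ext.
  - by rewrite !(comp_assoc sec1); exact: e.
  - by rewrite !(comp_assoc sec2). }
have e2 : q2 ∘ u = q2 ∘ v.
{ apply: sec_ext.
  - by rewrite !(comp_assoc sec1) -h2 -!(comp_assoc sec2) e1.
  - by rewrite !(comp_assoc sec2) -h1 -!(comp_assoc sec1) e1. }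
exact: pb_ext.
Qed.

Lemma iso_lift_exists (z : C) (x : Hom z (mors B)) :
  internal_iso x -> exists u : Hom z iso_mors, iso_inc ∘ u = x.
Proof.
move=> /internal_isoP[y [H H' e e']].
have [u [u1 u2]] := sec_lift H e; rewrite H in e'.
have [v [v1 v2]] := sec_lift H' e'.
have sq : prd_pair sec1 sec2 ∘ u = prd_pair sec2 sec1 ∘ v.
{ apply: prd_ext; rewrite !comp_assoc ?prd_pair_fst ?prd_pair_snd.
  - by rewrite u1 v2.
  - by rewrite u2 v1. }
by exists (pb_pair sq); rewrite /iso_inc -comp_assoc pb_pair_fst.
Qed.

Definition iso_lift (z : C) (x : Hom z (mors B)) (Hx : internal_iso x) :
  Hom z iso_mors :=
  proj1_sig (constructive_indefinite_description _ (iso_lift_exists Hx)).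

Lemma iso_liftK (z : C) (x : Hom z (mors B)) (Hx : internal_iso x) :
  iso_inc ∘ iso_lift Hx = x.
Proof. by rewrite /iso_lift; case: constructive_indefinite_description. Qed.

Definition iso_src : Hom iso_mors (obs B) := src B ∘ iso_inc.
Definition iso_tgt : Hom iso_mors (obs B) := tgt B ∘ iso_inc.

Lemma iso_mul_ok :
  tgt B ∘ (iso_inc ∘ pb_fst iso_tgt iso_src) =
  src B ∘ (iso_inc ∘ pb_snd iso_tgt iso_src).
Proof.
rewrite (comp_assoc (tgt B)) (comp_assoc (src B)).
exact: pb_square iso_tgt iso_src.
Qed.

Lemma iso_mul_iso : internal_iso (icmp iso_mul_ok).
Proof.
rewrite icmpE; apply: internal_iso_ct; first exact: iso_mul_ok.
- exact: internal_iso_pre iso_inc_iso.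
- exact: internal_iso_pre iso_inc_iso.
Qed.

Lemma idn_iso : internal_iso (idn B).
Proof. by rewrite -(comp_id_r (idn B)); exact: internal_iso_idn. Qed.

Definition iso_idn : Hom (obs B) iso_mors := iso_lift idn_iso.
Definition iso_mul : Hom (pb iso_tgt iso_src) iso_mors := iso_lift iso_mul_iso.

Lemma iso_mulE (z : C) (u : Hom z (pb iso_tgt iso_src)) :
  iso_inc ∘ (iso_mul ∘ u) = ct (iso_inc ∘ (pb_fst iso_tgt iso_src ∘ u))
                               (iso_inc ∘ (pb_snd iso_tgt iso_src ∘ u)).
Proof.
rewrite comp_assoc iso_liftK icmpE ct_pre; first exact: iso_mul_ok.
by rewrite -!comp_assoc.
Qed.

End IsoObject.

Definition iso (B : IntCat) : IntCat.
Proof.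
unshelve refine {| src := iso_src B; tgt := iso_tgt B; idn := iso_idn B;
  mul := iso_mul B |}.
- by rewrite /iso_src -comp_assoc iso_liftK src_idn.
- by rewrite /iso_tgt -comp_assoc iso_liftK tgt_idn.
- rewrite /iso_src /iso_mul -(comp_assoc (src B)) iso_liftK icmpE.
  by rewrite (src_ct (iso_mul_ok B)) (comp_assoc (src B)).
- rewrite /iso_tgt /iso_mul -(comp_assoc (tgt B)) iso_liftK icmpE.
  by rewrite (tgt_ct (iso_mul_ok B)) (comp_assoc (tgt B)).
- apply: iso_inc_mono; rewrite iso_mulE pb_pair_fst pb_pair_snd !comp_id_r.
  by rewrite comp_assoc iso_liftK ct_id_l.
- apply: iso_inc_mono; rewrite iso_mulE pb_pair_fst pb_pair_snd !comp_id_r.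
  by rewrite comp_assoc iso_liftK ct_id_r.
- apply: iso_inc_mono.
  rewrite !iso_mulE !pb_pair_fst !pb_pair_snd !iso_mulE.
  have ok := iso_mul_ok B.
  set p12 := pb_fst (pb_snd _ _) _; set p23 := pb_snd (pb_snd _ _) _.
  have sq : pb_snd _ _ ∘ p12 = pb_fst _ _ ∘ p23 := pb_square _ _.
  rewrite ct_assoc ?sq //.
  + by have := f_equal (fun k => k ∘ p12) ok; rewrite /= -!comp_assoc sq.
  + by have := f_equal (fun k => k ∘ p23) ok; rewrite /= -!comp_assoc.
Defined.

Lemma iso_inc_idn (B : IntCat) : iso_inc B ∘ idn (iso B) = idn B.
Proof. exact: iso_liftK. Qed.

Lemma iso_inc_ct (B : IntCat) (z : C) (u v : Hom z (mors (iso B))) :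
  tgt (iso B) ∘ u = src (iso B) ∘ v ->
  iso_inc B ∘ ct u v = ct (iso_inc B ∘ u) (iso_inc B ∘ v).
Proof.
by move=> H; rewrite -(icmpE H) /icmp iso_mulE pb_pair_fst pb_pair_snd.
Qed.

Definition iso_incl (B : IntCat) : IntFun (iso B) B.
Proof.
apply: (@IntFun_mk (iso B) B (idm _) (iso_inc B)).
- by rewrite comp_id_l.
- by rewrite comp_id_l.
- by rewrite comp_id_r iso_inc_idn.
- by rewrite mulE iso_inc_ct //; exact: pb_square.
Defined.

Definition iso_map1 (A B : IntCat) (F : IntFun A B) :
  Hom (iso_mors A) (iso_mors B) :=
  iso_lift (internal_iso_fun F (iso_inc_iso A)).

Lemma iso_map1K (A B : IntCat) (F : IntFun A B) :
  iso_inc B ∘ iso_map1 F = fun1 F ∘ iso_inc A.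
Proof. exact: iso_liftK. Qed.

Lemma iso_map1_src (A B : IntCat) (F : IntFun A B) :
  iso_src B ∘ iso_map1 F = fun0 F ∘ iso_src A.
Proof.
by rewrite -(comp_assoc (src B)) iso_map1K comp_assoc fun_src -comp_assoc.
Qed.

Lemma iso_map1_tgt (A B : IntCat) (F : IntFun A B) :
  iso_tgt B ∘ iso_map1 F = fun0 F ∘ iso_tgt A.
Proof.
by rewrite -(comp_assoc (tgt B)) iso_map1K comp_assoc fun_tgt -comp_assoc.
Qed.

Definition iso_map (A B : IntCat) (F : IntFun A B) : IntFun (iso A) (iso B).
Proof.
apply: (@IntFun_mk (iso A) (iso B) (fun0 F) (iso_map1 F)).
- exact: (iso_map1_src F).
- exact: (iso_map1_tgt F).
- apply: iso_inc_mono; rewrite comp_assoc iso_map1K -(comp_assoc (fun1 F)).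
  by rewrite iso_inc_idn (fun_idn F) comp_assoc iso_inc_idn.
- have sq := pb_square (tgt (iso A)) (src (iso A)).
  have ok : tgt A ∘ (iso_inc A ∘ pb_fst (tgt (iso A)) (src (iso A))) =
            src A ∘ (iso_inc A ∘ pb_snd (tgt (iso A)) (src (iso A))).
    by rewrite (comp_assoc (tgt A)) (comp_assoc (src A)).
  have ok' : tgt (iso B) ∘ (iso_map1 F ∘ pb_fst (tgt (iso A)) (src (iso A))) =
             src (iso B) ∘ (iso_map1 F ∘ pb_snd (tgt (iso A)) (src (iso A))).
    have es : src (iso B) ∘ iso_map1 F = fun0 F ∘ src (iso A) := iso_map1_src F.
    have et : tgt (iso B) ∘ iso_map1 F = fun0 F ∘ tgt (iso A) := iso_map1_tgt F.
    by rewrite (comp_assoc (tgt (iso B))) (comp_assoc (src (iso B))) es et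
       -!(comp_assoc (fun0 F)) sq.
  apply: iso_inc_mono; rewrite mulE comp_assoc iso_map1K -(comp_assoc (fun1 F)).
  rewrite (iso_inc_ct sq) (fun_ct F ok) (iso_inc_ct ok').
  by rewrite !(comp_assoc (iso_inc B)) iso_map1K -!(comp_assoc (fun1 F)).
Defined.

Lemma iso_groupoid (B : IntCat) : is_groupoid (iso B).
Proof.
have /internal_isoP[y [l1 l2 l3 l4]] := iso_inc_iso B.
have hy : internal_iso y.
  by apply/internal_isoP; exists (iso_inc B); split; rewrite // ?l4 ?l3 ?l1 ?l2.
have ky : iso_inc B ∘ iso_lift hy = y := iso_liftK hy.
have k1 : tgt (iso B) ∘ idm _ = src (iso B) ∘ iso_lift hy.
  by rewrite comp_id_r -(comp_assoc (src B)) ky.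
have k2 : tgt (iso B) ∘ iso_lift hy = src (iso B) ∘ idm _.
  by rewrite comp_id_r -(comp_assoc (tgt B)) ky.
apply/internal_isoP; exists (iso_lift hy); split => //.
- apply: iso_inc_mono; rewrite (iso_inc_ct k1) ky (comp_id_r (iso_inc B)) l3.
  by rewrite (comp_assoc (iso_inc B)) iso_inc_idn comp_id_r.
- apply: iso_inc_mono; rewrite (iso_inc_ct k2) ky (comp_id_r (iso_inc B)) l4.
  by rewrite (comp_assoc (iso_inc B)) iso_inc_idn comp_id_r.
Qed.

(* [iso] is the right adjoint of the inclusion of internal groupoids, with
   counit [iso_incl]. *)
Lemma iso_coreflection (G B : IntCat) (F : IntFun G B) : is_groupoid G ->
  exists! F' : IntFun G (iso B), IntFun_comp (iso_incl B) F' = F.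
Proof.
move=> hG.
have hF : internal_iso (fun1 F).
  by rewrite -(comp_id_r (fun1 F)); exact: internal_iso_fun.
have k : iso_inc B ∘ iso_lift hF = fun1 F := iso_liftK hF.
have hs : src (iso B) ∘ iso_lift hF = fun0 F ∘ src G.
  by rewrite -(comp_assoc (src B)) k fun_src.
have ht : tgt (iso B) ∘ iso_lift hF = fun0 F ∘ tgt G.
  by rewrite -(comp_assoc (tgt B)) k fun_tgt.
have hi : iso_lift hF ∘ idn G = idn (iso B) ∘ fun0 F.
  apply: iso_inc_mono; rewrite comp_assoc k fun_idn.
  by rewrite comp_assoc iso_inc_idn.
have hm : iso_lift hF ∘ mul G =
          ct (B := iso B) (iso_lift hF ∘ pb_fst _ _) (iso_lift hF ∘ pb_snd _ _).
  have sq := pb_square (tgt G) (src G).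
  apply: iso_inc_mono; rewrite comp_assoc k {1}mulE fun_ct // iso_inc_ct.
    by rewrite !comp_assoc hs ht -!comp_assoc sq.
  by rewrite !(comp_assoc (iso_inc B)) k.
exists (IntFun_mk hs ht hi hm); split.
  by apply: IntFun_eq; rewrite //= comp_id_l.
move=> F' e; apply: IntFun_eq => /=.
  by rewrite -e /= comp_id_l.
by apply: iso_inc_mono; rewrite k -e.
Qed.

(* The square with sides F1 (top), F0 x F0 (bottom) and (s, t) (vertical). *)
Definition fully_faithful (A B : IntCat) (F : IntFun A B) : Prop :=
  is_pullback (prd_map (fun0 F) (fun0 F)) (prd_pair (src B) (tgt B))
              (prd_pair (src A) (tgt A)) (fun1 F).

(* The object of objects A_0 x_{B_0} iso(B)_1 of the category P_F: pairs of
   an object a of A and an internal isomorphism of B with target F(a). *)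
Definition PF0 (A B : IntCat) (F : IntFun A B) : C := pb (fun0 F) (tgt (iso B)).

Definition PF0_proj (A B : IntCat) (F : IntFun A B) :
  Hom (PF0 F) (mors (iso B)) := pb_snd (fun0 F) (tgt (iso B)).

(* The comparison iso(A)_1 -> (P_F)_0 with components t and iso(F)_1. *)
Definition PF0_comparison (A B : IntCat) (F : IntFun A B) :
  Hom (mors (iso A)) (PF0 F) :=
  pb_pair (f := fun0 F) (g := tgt (iso B)) (u := tgt (iso A))
    (v := fun1 (iso_map F)) (esym (fun_tgt (iso_map F))).

End ChosenLimits.

Arguments CatC {C} HC.
Arguments pb {C} HC {a b z} f g.

Definition Cat (C : Category) (HC : finitely_complete C) : Category :=
  underlying (CatC HC).

Record Sieve (C : Category) (x : C) := {
  in_sieve :> forall u : C, Hom u x -> Prop;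
  sieve_closed : forall u v (f : Hom u x) (g : Hom v u),
    in_sieve f -> in_sieve (f ∘ g)
}.

Definition sieve_pullback (C : Category) (x y : C) (h : Hom y x)
  (S : Sieve x) : Sieve y.
Proof.
exists (fun u f => S u (h ∘ f)).
by move=> u v f g hf; rewrite comp_assoc; exact: sieve_closed.
Defined.

Definition is_maximal_sieve (C : Category) (x : C) (S : Sieve x) : Prop :=
  forall u (f : Hom u x), S u f.

Record GrothendieckTopology (C : Category) := {
  covering :> forall x : C, Sieve x -> Prop;
  covering_max : forall (x : C) (S : Sieve x),
    is_maximal_sieve S -> covering S;
  covering_stable : forall (x y : C) (h : Hom y x) (S : Sieve x),
    covering S -> covering (sieve_pullback h S);
  covering_trans : forall (x : C) (S R : Sieve x), covering S ->
    (forall u (f : Hom u x), S u f -> covering (sieve_pullback f R)) ->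
    covering R
}.

Definition trivial_topology (C : Category) : GrothendieckTopology C.
Proof.
exists (@is_maximal_sieve C).
- by [].
- by move=> x y h S hS u f; exact: hS.
- move=> x S R hS hR u f.
  by have := hR u f (hS u f) u (idm u); rewrite /= comp_id_r.
Defined.

Section Topology.
Variables (C : Category) (T : GrothendieckTopology C).

(* The elementary form of: the sheafification of the presheaf morphism
   represented by p is an epimorphism of sheaves. *)
Definition T_epi (e b : C) (p : Hom e b) : Prop :=
  forall (x : C) (g : Hom x b), exists S : Sieve x, covering T S /\
    forall u (f : Hom u x), S u f -> exists v : Hom u e, p ∘ v = g ∘ f.

Definition T_projective (p : C) : Prop :=
  forall (q r : C) (G : Hom q r), T_epi G ->
  forall H : Hom p r, exists F : Hom p q, G ∘ F = H.

Definition enough_T_projectives : Prop :=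
  forall b : C, exists (p : C) (e : Hom p b), T_projective p /\ T_epi e.
End Topology.

Section Model.
Variable D : Category.

Definition mor_class := forall a b : D, Hom a b -> Prop.

Implicit Types L R W Co Fi : mor_class.

Definition meet_class L R : mor_class := fun a b f => L a b f /\ R a b f.

(* i has the left lifting property with respect to p. *)
Definition lifts (a b x y : D) (i : Hom a b) (p : Hom x y) : Prop :=
  forall (f : Hom a x) (g : Hom b y), p ∘ f = g ∘ i ->
  exists h : Hom b x, h ∘ i = f /\ p ∘ h = g.

Definition llp R : mor_class := fun a b i =>
  forall (x y : D) (p : Hom x y), R x y p -> lifts i p.

Definition rlp L : mor_class := fun x y p =>
  forall (a b : D) (i : Hom a b), L a b i -> lifts i p.

Definition weak_factorization_system L R : Prop :=
  [/\ forall (a b : D) (f : Hom a b), L a b f <-> llp R f,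
      forall (a b : D) (f : Hom a b), R a b f <-> rlp L f &
      forall (a b : D) (f : Hom a b), exists (c : D) (i : Hom a c) (p : Hom c b),
        [/\ L a c i, R c b p & f = p ∘ i]].

Definition two_out_of_three W : Prop :=
  forall (a b c : D) (f : Hom a b) (g : Hom b c),
  [/\ W a b f -> W b c g -> W a c (g ∘ f),
      W a b f -> W a c (g ∘ f) -> W b c g &
      W b c g -> W a c (g ∘ f) -> W a b f].

(* f is a retract of g in the category of morphisms. *)
Definition is_retract (a b x y : D) (f : Hom a b) (g : Hom x y) : Prop :=
  exists (i : Hom a x) (r : Hom x a) (j : Hom b y) (s : Hom y b),
  [/\ r ∘ i = idm a, s ∘ j = idm b, g ∘ i = j ∘ f & f ∘ r = s ∘ g].

Definition retract_closed W : Prop :=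
  forall (a b x y : D) (f : Hom a b) (g : Hom x y),
  is_retract f g -> W x y g -> W a b f.

(* Closure of Co and Fi under retracts follows from the two factorization
   systems. *)
Definition is_model_structure W Co Fi : Prop :=
  [/\ two_out_of_three W, retract_closed W,
      weak_factorization_system (meet_class Co W) Fi &
      weak_factorization_system Co (meet_class Fi W)].

Definition fibrant Fi (a : D) : Prop :=
  forall (t : D) (f : Hom a t), is_terminal t -> Fi a t f.

Definition cofibrant Co (a : D) : Prop :=
  forall (i : D) (f : Hom i a), is_initial i -> Co i a f.
End Model.

Definition is_trivial_model_structure (K : TwoCategory)
    (W Co Fi : mor_class (underlying K)) : Prop :=
  [/\ is_model_structure W Co Fi,
      forall (A B : K) (f : HomC A B),
        W A B f <-> forall E : K, is_equivalence (postcomp E f) &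
      forall (A B : K) (f : HomC A B),
        Fi A B f <-> forall E : K, is_isofibration (postcomp E f)].

Section TopologyClasses.
Variables (C : Category) (HC : finitely_complete C).
Variable T : GrothendieckTopology C.

Definition T_equivalence : mor_class (Cat HC) :=
  fun (A B : IntCat HC) (F : IntFun A B) =>
  T_epi T (src (iso B) ∘ PF0_proj F) /\ fully_faithful F.

Definition T_fibration : mor_class (Cat HC) :=
  fun (A B : IntCat HC) (F : IntFun A B) => T_epi T (PF0_comparison F).

Definition acyclic_T_fibration : mor_class (Cat HC) :=
  meet_class T_fibration T_equivalence.

Definition T_cofibration : mor_class (Cat HC) := llp acyclic_T_fibration.
End TopologyClasses.

Arguments T_equivalence {C} HC T.
Arguments T_fibration {C} HC T.
Arguments acyclic_T_fibration {C} HC T.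
Arguments T_cofibration {C} HC T.

(* Main.v *)
(* For the trivial topology the epis are the split epis, so each class becomes
   a statement about generalized elements: an acyclic fibration is a fully
   faithful functor F with F_0 split epi, and a functor into its domain is the
   same as a functor into its codomain with a lift of the object part.  Hence
   i : A -> E is a cofibration as soon as E_0 = (A + B)_0 and i_0 is the
   injection, which gives the factorization (cofibration, acyclic fibration)
   with E the full image of [F, id] : A + B -> B.  Composing it with the path
   object factorization A -> P_F -> B gives the other one.

   An acyclic cofibration i lifts against the acyclic fibration P_i -> X; this
   yields a retraction r with an isomorphism 1 => ir that is trivial on A.
   Liftings against a fibration p : E -> D are obtained by first lifting to
   iso(E)_1 along the split epi iso(E)_1 -> (P_p)_0, and then conjugating a
   functor X -> E by the resulting isomorphism.  The comparison with the
   trivial model structure of the 2-category is tested on P_F for fibrations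
   and on A and B for equivalences. *)
Require Import Defs.
From Corelib Require Import ssreflect ssrfun ssrbool.
From Stdlib Require Import ClassicalEpsilon.

Set Implicit Arguments.
Unset Strict Implicit.
Unset Printing Implicit Defensive.
Local Open Scope cat_scope.

(** * Isomorphic objects, the retract argument, binary coproducts *)

Lemma isomorphic_refl (D : Category) (a : D) : isomorphic a a.
Proof. by exists (idm a), (idm a); rewrite !comp_id_l. Qed.

Lemma isomorphic_sym (D : Category) (a b : D) : isomorphic a b -> isomorphic b a.
Proof. by move=> [f [g [h1 h2]]]; exists g, f. Qed.

Lemma isomorphic_trans (D : Category) (a b c : D) :
  isomorphic a b -> isomorphic b c -> isomorphic a c.
Proof.
move=> [f [f' [f1 f2]]] [g [g' [g1 g2]]]; exists (g ∘ f), (f' ∘ g'); split.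
- by rewrite -comp_assoc (comp_assoc g') g1 comp_id_l.
- by rewrite -comp_assoc (comp_assoc f) f2 comp_id_l.
Qed.

Lemma fmap_isomorphic (D E : Category) (F : Functor D E) (a b : D) :
  isomorphic a b -> isomorphic (F a) (F b).
Proof.
move=> [f [g [h1 h2]]]; exists (fmap F f), (fmap F g).
by rewrite -!fmap_comp h1 h2 !fmap_id.
Qed.

(** Apply a quasi-inverse [G] and compare [G (F a)] with [a] through the natural isomorphism from
    [Fcomp G F] to the identity. *)
Lemma equivalence_reflects_isomorphic (D E : Category) (F : Functor D E)
    (a b : D) : is_equivalence F -> isomorphic (F a) (F b) -> isomorphic a b.
Proof.
move=> [G [[w [_ hw]] _]] h.
have iw c : isomorphic (G (F c)) c by exists (w c); exact: hw.
apply: isomorphic_trans (iw b); apply: isomorphic_trans (isomorphic_sym (iw a)) _.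
exact: fmap_isomorphic.
Qed.

(** The retract argument: a filler of the square with top [i] and bottom the identity is a section
    of [q] under [a]. *)
Lemma lifts_retract_left (D : Category) (a b c : D) (f : Hom a b) (i : Hom a c)
    (q : Hom c b) : f = q ∘ i -> lifts f q -> is_retract f i.
Proof.
move=> e l; have [|h [h1 h2]] := l i (idm b); first by rewrite comp_id_l.
exists (idm a), (idm a), h, q; split; rewrite ?comp_id_l ?comp_id_r //.
Qed.

Lemma lifts_retract_right (D : Category) (a b c : D) (f : Hom a b) (i : Hom a c)
    (q : Hom c b) : f = q ∘ i -> lifts i f -> is_retract f q.
Proof.
move=> e l; have [|h [h1 h2]] := l (idm a) q; first by rewrite comp_id_r.
exists i, h, (idm b), (idm b); split; rewrite ?comp_id_l ?comp_id_r //.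
Qed.

Lemma coproduct_exists (D : Category) (HD : finitely_cocomplete D) (a b : D) :
  exists (c : D) (i : Hom a c) (j : Hom b c),
    forall (x : D) (u : Hom a x) (v : Hom b x),
      exists! w : Hom c x, w ∘ i = u /\ w ∘ j = v.
Proof.
have [L HL] := HD _ finite_PairCat (pair_diagram a b).
exists L, (coleg L true), (coleg L false) => x u v.
pose lg (j : PairCat) : Hom (pair_diagram a b j) x :=
  match j with true => u | false => v end.
have lg_nat i j (h : Hom i j) : lg j ∘ fmap (pair_diagram a b) h = lg i.
  by move: i j h => [] [] [] /=; rewrite ?comp_id_r.
have [w [hw uw]] := HL (Build_Cocone lg_nat).
exists w; split; first by split; [exact: (hw true)|exact: (hw false)].
by move=> w' [h1 h2]; apply: uw => -[].
Qed.

Section InternalCategories.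
Context {C : Category} {HC : finitely_complete C}.
Implicit Types A B D : IntCat HC.

(** * Calculus of generalized elements *)

Lemma src_idn_pre B (z : C) (a : Hom z (obs B)) : src B ∘ (idn B ∘ a) = a.
Proof. by rewrite comp_assoc src_idn comp_id_l. Qed.

Lemma tgt_idn_pre B (z : C) (a : Hom z (obs B)) : tgt B ∘ (idn B ∘ a) = a.
Proof. by rewrite comp_assoc tgt_idn comp_id_l. Qed.

Lemma fun_src_pre A B (F : IntFun A B) (z : C) (f : Hom z (mors A)) :
  src B ∘ (fun1 F ∘ f) = fun0 F ∘ (src A ∘ f).
Proof. by rewrite !comp_assoc fun_src. Qed.

Lemma fun_tgt_pre A B (F : IntFun A B) (z : C) (f : Hom z (mors A)) :
  tgt B ∘ (fun1 F ∘ f) = fun0 F ∘ (tgt A ∘ f).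
Proof. by rewrite !comp_assoc fun_tgt. Qed.

Lemma fun_idn_pre A B (F : IntFun A B) (z : C) (a : Hom z (obs A)) :
  fun1 F ∘ (idn A ∘ a) = idn B ∘ (fun0 F ∘ a).
Proof. by rewrite !comp_assoc fun_idn. Qed.

Lemma nt_src_pre A B (F G : IntFun A B) (al : IntNat F G) (z : C)
  (a : Hom z (obs A)) : src B ∘ (nt al ∘ a) = fun0 F ∘ a.
Proof. by rewrite comp_assoc nt_src. Qed.

Lemma nt_tgt_pre A B (F G : IntFun A B) (al : IntNat F G) (z : C)
  (a : Hom z (obs A)) : tgt B ∘ (nt al ∘ a) = fun0 G ∘ a.
Proof. by rewrite comp_assoc nt_tgt. Qed.

Lemma nt_natE A B (F G : IntFun A B) (al : IntNat F G) (z : C)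
  (f : Hom z (mors A)) :
  ct (fun1 F ∘ f) (nt al ∘ (tgt A ∘ f)) = ct (nt al ∘ (src A ∘ f)) (fun1 G ∘ f).
Proof. exact: nt_ct. Qed.

(** With its mirror image below, this is how equalities of conjugated morphisms are proved: compose
    with the conjugating isomorphism, use naturality, cancel. *)
Lemma ct_cancel_r B (z : C) (f g h : Hom z (mors B)) : internal_iso h ->
  tgt B ∘ f = src B ∘ h -> tgt B ∘ g = src B ∘ h -> ct f h = ct g h -> f = g.
Proof.
move=> /internal_isoP[k [k1 k2 k3 _]] hf hg e.
rewrite -(ct_id_r (esym hf)) -k3 -ct_assoc // e ct_assoc // k3 ct_id_r //.
Qed.

Lemma ct_cancel_l B (z : C) (f g h : Hom z (mors B)) : internal_iso h ->
  tgt B ∘ h = src B ∘ f -> tgt B ∘ h = src B ∘ g -> ct h f = ct h g -> f = g.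
Proof.
move=> /internal_isoP[k [k1 k2 _ k4]] hf hg e.
rewrite -(ct_id_l hf) -k4 ct_assoc // e -ct_assoc // k4 ct_id_l //.
Qed.

(** * Fully faithful functors *)

Lemma fully_faithfulP A B (F : IntFun A B) : fully_faithful F <->
  forall (z : C) (a a' : Hom z (obs A)) (f : Hom z (mors B)),
    src B ∘ f = fun0 F ∘ a -> tgt B ∘ f = fun0 F ∘ a' ->
    exists! g : Hom z (mors A),
      [/\ src A ∘ g = a, tgt A ∘ g = a' & fun1 F ∘ g = f].
Proof.
split=> [[_ U] z a a' f hs ht|H].
- have [|g [[g1 g2] ug]] := U z (prd_pair HC a a') f.
    by apply: prd_ext; rewrite !comp_assoc !(prd_pair_fst, prd_pair_snd)
      -comp_assoc !(prd_pair_fst, prd_pair_snd).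
  have k1 := f_equal (fun k => prd_fst _ _ _ ∘ k) g1.
  have k2 := f_equal (fun k => prd_snd _ _ _ ∘ k) g1.
  rewrite /= !comp_assoc !(prd_pair_fst, prd_pair_snd) in k1 k2.
  exists g; split=> // g' [h1 h2 h3]; apply: ug; split=> //.
  by apply: prd_ext; rewrite !comp_assoc !(prd_pair_fst, prd_pair_snd).
- split.
    apply: prd_ext; rewrite !comp_assoc !(prd_pair_fst, prd_pair_snd) -comp_assoc.
      by rewrite prd_pair_fst fun_src.
    by rewrite prd_pair_snd fun_tgt.
  move=> z u f e.
  have e1 := f_equal (fun k => prd_fst _ _ _ ∘ k) e.
  have e2 := f_equal (fun k => prd_snd _ _ _ ∘ k) e.
  rewrite /= !comp_assoc !(prd_pair_fst, prd_pair_snd) in e1 e2.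
  rewrite -comp_assoc in e1; rewrite -comp_assoc in e2.
  have [g [[g1 g2 g3] ug]] := H z _ _ f (esym e1) (esym e2).
  exists g; split.
    by split=> //; apply: prd_ext; rewrite !comp_assoc !(prd_pair_fst, prd_pair_snd).
  move=> g' [h1 h2]; apply: ug; split=> //; rewrite -h1 !comp_assoc.
    by rewrite prd_pair_fst.
  by rewrite prd_pair_snd.
Qed.

Lemma ff_full A B (F : IntFun A B) : fully_faithful F ->
  forall (z : C) (a a' : Hom z (obs A)) (f : Hom z (mors B)),
    src B ∘ f = fun0 F ∘ a -> tgt B ∘ f = fun0 F ∘ a' ->
    exists g : Hom z (mors A),
      [/\ src A ∘ g = a, tgt A ∘ g = a' & fun1 F ∘ g = f].
Proof.
by move=> /fully_faithfulP ff z a a' f h1 h2; have [g []] := ff z a a' f h1 h2; exists g.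
Qed.

Lemma ff_inj A B (F : IntFun A B) : fully_faithful F ->
  forall (z : C) (g g' : Hom z (mors A)), src A ∘ g = src A ∘ g' ->
    tgt A ∘ g = tgt A ∘ g' -> fun1 F ∘ g = fun1 F ∘ g' -> g = g'.
Proof.
move=> /fully_faithfulP ff z g g' h1 h2 h3.
have [||k [_ u]] := ff z (src A ∘ g') (tgt A ∘ g') (fun1 F ∘ g').
  exact: fun_src_pre.
  exact: fun_tgt_pre.
by rewrite -(u g) // -(u g').
Qed.

(** Fullness lifts the inverse; faithfulness checks that both composites are identities. *)
Lemma ff_reflects_iso A B (F : IntFun A B) (z : C) (g : Hom z (mors A)) :
  fully_faithful F -> internal_iso (fun1 F ∘ g) -> internal_iso g.
Proof.
move=> ff /internal_isoP[y [h1 h2 h3 h4]].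
rewrite !(fun_src_pre, fun_tgt_pre) in h1 h2 h3 h4.
have [y' [y1 y2 e]] := ff_full ff (esym h1) h2.
apply/internal_isoP; exists y'; split=> //.
- apply: (ff_inj ff).
  + by rewrite src_ct // src_idn_pre.
  + by rewrite tgt_ct // tgt_idn_pre.
  + by rewrite fun_ct // e h3 fun_idn_pre.
- apply: (ff_inj ff).
  + by rewrite src_ct // src_idn_pre.
  + by rewrite tgt_ct // tgt_idn_pre.
  + by rewrite fun_ct // e h4 fun_idn_pre.
Qed.

(** The morphism part is the unique lift of [fun1 G] with ends prescribed by [k]. Its functor laws
    hold after applying [F], where they are those of [G], and faithfulness reflects them. *)
Lemma ff_lift A B D (F : IntFun A B) (G : IntFun D B)
    (k : Hom (obs D) (obs A)) : fully_faithful F -> fun0 F ∘ k = fun0 G ->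
  exists K : IntFun D A, IntFun_comp F K = G /\ fun0 K = k.
Proof.
move=> ff e.
have [||g [g1 g2 g3]] := ff_full ff (a := k ∘ src D) (a' := k ∘ tgt D) (f := fun1 G).
  by rewrite fun_src comp_assoc e.
  by rewrite fun_tgt comp_assoc e.
have sq := pb_square HC (tgt D) (src D).
have ok : tgt A ∘ (g ∘ pb_fst HC (tgt D) (src D)) =
          src A ∘ (g ∘ pb_snd HC (tgt D) (src D)).
  by rewrite !comp_assoc g1 g2 -!comp_assoc sq.
have hi : g ∘ idn D = idn A ∘ k.
{ apply: (ff_inj ff).
  - by rewrite src_idn_pre comp_assoc g1 -comp_assoc src_idn comp_id_r.
  - by rewrite tgt_idn_pre comp_assoc g2 -comp_assoc tgt_idn comp_id_r.
  - by rewrite fun_idn_pre comp_assoc g3 fun_idn e. }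
have hm : g ∘ mul D = ct (g ∘ pb_fst _ _ _) (g ∘ pb_snd _ _ _).
{ apply: (ff_inj ff).
  - by rewrite src_ct // !comp_assoc g1 -!comp_assoc src_mul.
  - by rewrite tgt_ct // !comp_assoc g2 -!comp_assoc tgt_mul.
  - by rewrite fun_ct // !comp_assoc g3 mulE fun_ct. }
exists (IntFun_mk g1 g2 hi hm); split=> //.
exact: IntFun_eq.
Qed.

Lemma ff_lift_unique A B D (F : IntFun A B) (K K' : IntFun D A) :
  fully_faithful F -> IntFun_comp F K = IntFun_comp F K' ->
  fun0 K = fun0 K' -> K = K'.
Proof.
move=> ff e e0; apply: IntFun_eq => //.
have e1 : fun1 (IntFun_comp F K) = fun1 (IntFun_comp F K') by rewrite e.
by apply: (ff_inj ff); rewrite ?fun_src ?fun_tgt ?e0.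
Qed.

Lemma ff_lift_nat A B D (F : IntFun A B) (K K' : IntFun D A)
    (al : IntNat (IntFun_comp F K) (IntFun_comp F K')) : fully_faithful F ->
  exists be : IntNat K K', fun1 F ∘ nt be = nt al.
Proof.
move=> ff.
have [b [b1 b2 b3]] := ff_full ff (nt_src al) (nt_tgt al).
have okl : tgt A ∘ fun1 K = src A ∘ (b ∘ tgt D) by rewrite fun_tgt comp_assoc b1.
have okr : tgt A ∘ (b ∘ src D) = src A ∘ fun1 K' by rewrite fun_src comp_assoc b2.
have hn : ct (fun1 K) (b ∘ tgt D) = ct (b ∘ src D) (fun1 K').
{ apply: (ff_inj ff).
  - by rewrite !src_ct // fun_src comp_assoc b1.
  - by rewrite !tgt_ct // fun_tgt comp_assoc b2.
  - by rewrite !fun_ct // !comp_assoc b3; have /= := nt_ct1 al. }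
by exists (IntNat_mk b1 b2 hn).
Qed.

(* G' f = h_s ; G f ; h_t^-1.  The functor laws are checked after composing
   with [h], where they reduce to those of [G]. *)
Lemma conj_functor A B (G : IntFun A B) (h : Hom (obs A) (mors B)) :
  internal_iso h -> tgt B ∘ h = fun0 G ->
  exists (G' : IntFun A B) (al : IntNat G' G),
    fun0 G' = src B ∘ h /\ nt al = h.
Proof.
move=> hi ht.
have his z (u : Hom z (obs A)) : internal_iso (h ∘ u) by exact: internal_iso_pre.
have /internal_isoP[k [k1 k2 k3 k4]] := hi.
have sq := pb_square HC (tgt A) (src A).
have o1 : tgt B ∘ (h ∘ src A) = src B ∘ fun1 G by rewrite comp_assoc ht fun_src.
have o2 : tgt B ∘ fun1 G = src B ∘ (k ∘ tgt A).
  by rewrite comp_assoc -k1 ht fun_tgt.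
have o3 : tgt B ∘ ct (h ∘ src A) (fun1 G) = src B ∘ (k ∘ tgt A) by rewrite tgt_ct.
pose g := ct (ct (h ∘ src A) (fun1 G)) (k ∘ tgt A).
have gs : src B ∘ g = src B ∘ h ∘ src A by rewrite !src_ct // comp_assoc.
have gt : tgt B ∘ g = src B ∘ h ∘ tgt A by rewrite !tgt_ct // comp_assoc k2.
have ok : tgt B ∘ g = src B ∘ (h ∘ tgt A) by rewrite gt comp_assoc.
have gh : ct g (h ∘ tgt A) = ct (h ∘ src A) (fun1 G).
  rewrite ct_assoc //; first by rewrite !comp_assoc k2.
  by rewrite -ct_pre // k4 -comp_assoc ct_id_r // tgt_ct // fun_tgt ht.
have ghp z (f : Hom z (mors A)) :
    ct (g ∘ f) (h ∘ (tgt A ∘ f)) = ct (h ∘ (src A ∘ f)) (fun1 G ∘ f).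
  by rewrite !(comp_assoc h) -!ct_pre // gh.
have okp z (f : Hom z (mors A)) : tgt B ∘ (g ∘ f) = src B ∘ (h ∘ (tgt A ∘ f)).
  by rewrite !comp_assoc gt.
have o1p z (f : Hom z (mors A)) :
    tgt B ∘ (h ∘ (src A ∘ f)) = src B ∘ (fun1 G ∘ f).
  by rewrite fun_src_pre comp_assoc ht.
have gi : g ∘ idn A = idn B ∘ (src B ∘ h).
{ apply: (ct_cancel_r (his _ (tgt A ∘ idn A))) => //.
  - by rewrite tgt_idn_pre tgt_idn comp_id_r.
  - rewrite ghp tgt_idn src_idn comp_id_r ct_id_l // fun_idn ct_id_r //. }
have gm : g ∘ mul A = ct (g ∘ pb_fst _ _ _) (g ∘ pb_snd _ _ _).
{ have okm : tgt B ∘ (g ∘ pb_fst HC (tgt A) (src A)) =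
             src B ∘ (g ∘ pb_snd HC (tgt A) (src A)).
    by rewrite !comp_assoc gs gt -!comp_assoc sq.
  apply: (ct_cancel_r (his _ (tgt A ∘ mul A))) => //.
  - by rewrite tgt_ct // tgt_mul okp.
  - rewrite ghp tgt_mul src_mul ct_assoc // ghp -ct_assoc ?o1p //.
      by rewrite okp sq.
    rewrite -sq ghp mulE fun_ct // ct_assoc ?o1p //.
    exact: fun_composable. }
exists (IntFun_mk gs gt gi gm).
by unshelve eexists (IntNat_mk _ ht _).
Qed.


(** * The three classes for the trivial topology *)

(** A maximal sieve contains the identity, so a local lift of [idm b] is a section; conversely a
    section lifts every map. *)
Lemma trivial_epiP (e b : C) (p : Hom e b) :
  T_epi (trivial_topology C) p <-> exists q : Hom b e, p ∘ q = idm b.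
Proof.
split=> [h|[q hq] x g].
- have [S [hS hp]] := h b (idm b).
  have [v hv] := hp b (idm b) (hS _ _).
  by exists v; rewrite hv comp_id_l.
- exists (@Build_Sieve C x (fun _ _ => True) (fun _ _ _ _ _ => I)); split=> //.
  by move=> u f _; exists (q ∘ (g ∘ f)); rewrite comp_assoc hq comp_id_l.
Qed.

Notation tau := (trivial_topology C).

(** A pair [(a, f)] is a generalized element of [PF0 F], and a section of the comparison map solves
    all such lifting problems. *)
Lemma fibrationP A B (F : IntFun A B) : T_fibration HC tau A B F <->
  forall (z : C) (a : Hom z (obs A)) (f : Hom z (mors B)), internal_iso f ->
    tgt B ∘ f = fun0 F ∘ a ->
    exists g : Hom z (mors A),
      [/\ internal_iso g, tgt A ∘ g = a & fun1 F ∘ g = f].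
Proof.
rewrite /T_fibration trivial_epiP; split=> [[q hq] z a f hf e|h].
- have e' : fun0 F ∘ a = tgt (iso B) ∘ iso_lift hf.
    by rewrite -e /= /iso_tgt -comp_assoc iso_liftK.
  have := f_equal (fun k => k ∘ pb_pair HC e') hq; rewrite comp_id_l => hq'.
  have h1 := f_equal (fun k => pb_fst _ _ _ ∘ k) hq'.
  have h2 := f_equal (fun k => iso_inc B ∘ (pb_snd _ _ _ ∘ k)) hq'.
  rewrite /= pb_pair_fst !comp_assoc pb_pair_fst /= in h1.
  rewrite /= pb_pair_snd iso_liftK !comp_assoc in h2.
  rewrite -(comp_assoc (iso_inc B)) pb_pair_snd iso_map1K in h2.
  exists (iso_inc A ∘ q ∘ pb_pair HC e'); split.
  + by rewrite -comp_assoc; exact: internal_iso_pre (iso_inc_iso A).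
  + by rewrite -[RHS]h1 2!(comp_assoc (tgt A)).
  + by rewrite -[RHS]h2 2!(comp_assoc (fun1 F)).
(* The two projections of [PF0 F] form the universal lifting problem; its solution is the required
   section. *)
- pose P := PF0 F.
  pose p1 : Hom P (obs A) := pb_fst _ _ _.
  pose p2 : Hom P (iso_mors B) := pb_snd _ _ _.
  have sq : tgt B ∘ (iso_inc B ∘ p2) = fun0 F ∘ p1.
    by rewrite comp_assoc; symmetry; exact: pb_square.
  have [|g [g1 g2 g3]] := h P p1 (iso_inc B ∘ p2) _ sq.
    exact: internal_iso_pre (iso_inc_iso B).
  exists (iso_lift g1); apply: pb_ext; rewrite comp_assoc comp_id_r.
    by rewrite pb_pair_fst /= /iso_tgt -comp_assoc iso_liftK.
  apply: iso_inc_mono; rewrite pb_pair_snd comp_assoc iso_map1K -comp_assoc.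
  by rewrite iso_liftK.
Qed.

(** A section of the map from [PF0 F] to [obs B] chooses for each object b an isomorphism from b to
    some F a. *)
Lemma equivalenceP A B (F : IntFun A B) : T_equivalence HC tau A B F <->
  fully_faithful F /\ exists (a : Hom (obs B) (obs A)) (f : Hom (obs B) (mors B)),
    [/\ internal_iso f, src B ∘ f = idm _ & tgt B ∘ f = fun0 F ∘ a].
Proof.
rewrite /T_equivalence trivial_epiP; split=> [[[q hq] ff]|[ff [a [f [f1 f2 f3]]]]].
- split=> //; exists (pb_fst _ _ _ ∘ q), (iso_inc B ∘ (pb_snd _ _ _ ∘ q)); split.
  + exact: internal_iso_pre (iso_inc_iso B).
  + by rewrite -hq (comp_assoc (src B)) comp_assoc.
  + rewrite (comp_assoc (tgt B)) comp_assoc (comp_assoc (fun0 F)); congr (_ ∘ _).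
    by symmetry; exact: (pb_square HC (fun0 F) (tgt (iso B))).
- split=> //.
  have e : fun0 F ∘ a = tgt (iso B) ∘ iso_lift f1.
    by rewrite -f3 /= /iso_tgt -comp_assoc iso_liftK.
  exists (pb_pair HC e); rewrite -comp_assoc pb_pair_snd /= /iso_src -comp_assoc.
  by rewrite iso_liftK.
Qed.

(** Lifting the chosen isomorphism from b to F a along the fibration yields an object lying strictly
    over b, namely the source of the lift. Conversely, full faithfulness lifts an isomorphism once a
    preimage of its source is chosen. *)
Lemma acyclic_fibrationP A B (F : IntFun A B) : acyclic_T_fibration HC tau A B F <->
  fully_faithful F /\ exists a : Hom (obs B) (obs A), fun0 F ∘ a = idm _.
Proof.
rewrite /acyclic_T_fibration /meet_class fibrationP equivalenceP.
split=> [[h [ff [a [f [f1 f2 f3]]]]]|[ff [a ha]]].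
- split=> //; have [g [g1 g2 g3]] := h _ a f f1 f3.
  by exists (src A ∘ g); rewrite -f2 -g3 fun_src_pre.
- split.
    move=> z b f hf e.
    have [|g [g1 g2 g3]] := ff_full ff (a := a ∘ (src B ∘ f)) _ e.
      by rewrite comp_assoc ha comp_id_l.
    by exists g; split=> //; apply: (ff_reflects_iso ff); rewrite g3.
  split=> //; exists a, (idn B ∘ idm _); split.
  + exact: internal_iso_idn.
  + by rewrite src_idn_pre.
  + by rewrite tgt_idn_pre ha.
Qed.

(** * Internal natural isomorphisms *)

Lemma nat_isoP A B (F G : IntFun A B) (al : IntNat F G) :
  @is_iso (HomCat A B) F G al <-> internal_iso (nt al).
Proof.
rewrite internal_isoP; split.
- move=> [be [h1 h2]]; exists (nt be); rewrite !nt_src !nt_tgt.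
  have k1 := f_equal (@nt _ _ _ _ _ _) h1; have k2 := f_equal (@nt _ _ _ _ _ _) h2.
  by rewrite /= !icmpE in k1 k2; split.
- move=> [k [h1 h2 h3 h4]].
  have ks : src B ∘ k = fun0 G by rewrite -h1 nt_tgt.
  have kt : tgt B ∘ k = fun0 F by rewrite h2 nt_src.
  rewrite nt_src in h3; rewrite nt_tgt in h4.
  have hi : internal_iso (nt al).
    by apply/internal_isoP; exists k; rewrite nt_src nt_tgt.
  (* The inverse [k] is natural: after composing with [nt al] on the left, this becomes naturality
     of [al]. *)
  have hn : ct (fun1 G) (k ∘ tgt A) = ct (k ∘ src A) (fun1 F).
  { have o1 : tgt B ∘ fun1 G = src B ∘ (k ∘ tgt A) by rewrite fun_tgt comp_assoc ks.
    have o2 : tgt B ∘ (k ∘ src A) = src B ∘ fun1 F by rewrite fun_src comp_assoc kt.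
    have o3 : tgt B ∘ (nt al ∘ src A) = src B ∘ fun1 G.
      by rewrite fun_src comp_assoc nt_tgt.
    have o4 : tgt B ∘ fun1 F = src B ∘ (nt al ∘ tgt A).
      by rewrite fun_tgt comp_assoc nt_src.
    apply: (ct_cancel_l (internal_iso_pre (src A) hi)).
    - by rewrite src_ct.
    - by rewrite src_ct // o3 fun_src !comp_assoc ks.
    - rewrite -ct_assoc // -nt_ct1 ct_assoc //.
        by rewrite !comp_assoc h1.
      rewrite -ct_pre // h3 -ct_assoc //; first by rewrite !comp_assoc h1.
      rewrite -(ct_pre (src A) h1) h3 -!comp_assoc ct_id_l ?fun_src //.
      by rewrite ct_id_r // fun_tgt. }
  exists (IntNat_mk ks kt hn).
  by split; apply: IntNat_eq; rewrite /= icmpE.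
Qed.

Lemma isomorphicP A B (F G : IntFun A B) : @isomorphic (HomCat A B) F G <->
  exists al : IntNat F G, internal_iso (nt al).
Proof.
by split=> -[al /nat_isoP h]; exists al.
Qed.

(** * Base change along a map of objects *)

(* The category with objects [z] and morphisms the triples
   (a, a', f : k a -> k a'). *)
Section BaseChange.
Variables (B : IntCat HC) (z : C) (k : Hom z (obs B)).

Definition base_mors : C := pb HC (prd_map HC k k) (prd_pair HC (src B) (tgt B)).
Definition base_src : Hom base_mors z := prd_fst HC z z ∘ pb_fst _ _ _.
Definition base_tgt : Hom base_mors z := prd_snd HC z z ∘ pb_fst _ _ _.
Definition base_arr : Hom base_mors (mors B) := pb_snd _ _ _.

Lemma base_arr_src : src B ∘ base_arr = k ∘ base_src.
Proof.
have := f_equal (fun u => prd_fst _ _ _ ∘ u)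
  (pb_square HC (prd_map HC k k) (prd_pair HC (src B) (tgt B))).
by rewrite !comp_assoc !prd_pair_fst => ->.
Qed.

Lemma base_arr_tgt : tgt B ∘ base_arr = k ∘ base_tgt.
Proof.
have := f_equal (fun u => prd_snd _ _ _ ∘ u)
  (pb_square HC (prd_map HC k k) (prd_pair HC (src B) (tgt B))).
by rewrite !comp_assoc !prd_pair_snd => ->.
Qed.

Lemma base_ext (x : C) (u v : Hom x base_mors) :
  base_src ∘ u = base_src ∘ v -> base_tgt ∘ u = base_tgt ∘ v ->
  base_arr ∘ u = base_arr ∘ v -> u = v.
Proof.
by move=> h1 h2 h3; apply: pb_ext => //; apply: prd_ext; rewrite !comp_assoc.
Qed.

Lemma base_lift (x : C) (a a' : Hom x z) (f : Hom x (mors B)) :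
  src B ∘ f = k ∘ a -> tgt B ∘ f = k ∘ a' ->
  exists u : Hom x base_mors,
    [/\ base_src ∘ u = a, base_tgt ∘ u = a' & base_arr ∘ u = f].
Proof.
move=> h1 h2.
have e : prd_map HC k k ∘ prd_pair HC a a' = prd_pair HC (src B) (tgt B) ∘ f.
  by apply: prd_ext; rewrite !comp_assoc !(prd_pair_fst, prd_pair_snd) -comp_assoc
    !(prd_pair_fst, prd_pair_snd).
exists (pb_pair HC e); rewrite /base_src /base_tgt /base_arr -!comp_assoc.
by rewrite pb_pair_fst pb_pair_snd prd_pair_fst prd_pair_snd.
Qed.

(** The morphism is chosen from an existence statement; [base_ext] makes it unique, so its three
    components in [base_mkP] suffice to compute with it. *)
Definition base_mk (x : C) (a a' : Hom x z) (f : Hom x (mors B))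
    (hs : src B ∘ f = k ∘ a) (ht : tgt B ∘ f = k ∘ a') : Hom x base_mors :=
  proj1_sig (constructive_indefinite_description _ (base_lift hs ht)).

Lemma base_mkP (x : C) (a a' : Hom x z) (f : Hom x (mors B))
    (hs : src B ∘ f = k ∘ a) (ht : tgt B ∘ f = k ∘ a') :
  [/\ base_src ∘ base_mk hs ht = a, base_tgt ∘ base_mk hs ht = a' &
      base_arr ∘ base_mk hs ht = f].
Proof. by rewrite /base_mk; case: constructive_indefinite_description. Qed.

Lemma base_composable (x : C) (u v : Hom x base_mors) :
  base_tgt ∘ u = base_src ∘ v ->
  tgt B ∘ (base_arr ∘ u) = src B ∘ (base_arr ∘ v).
Proof.
move=> e; rewrite (comp_assoc (tgt B)) base_arr_tgt (comp_assoc (src B)).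
by rewrite base_arr_src -!(comp_assoc k) e.
Qed.

Lemma base_idn_src : src B ∘ (idn B ∘ k) = k ∘ idm z.
Proof. by rewrite src_idn_pre comp_id_r. Qed.

Lemma base_idn_tgt : tgt B ∘ (idn B ∘ k) = k ∘ idm z.
Proof. by rewrite tgt_idn_pre comp_id_r. Qed.

Notation sq := (base_composable (pb_square HC base_tgt base_src)).

Lemma base_mul_src :
  src B ∘ icmp sq = k ∘ (base_src ∘ pb_fst HC base_tgt base_src).
Proof.
by rewrite icmpE src_ct ?sq // (comp_assoc (src B)) base_arr_src -(comp_assoc k).
Qed.

Lemma base_mul_tgt :
  tgt B ∘ icmp sq = k ∘ (base_tgt ∘ pb_snd HC base_tgt base_src).
Proof.
by rewrite icmpE tgt_ct ?sq // (comp_assoc (tgt B)) base_arr_tgt -(comp_assoc k).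
Qed.

Lemma base_mulE (x : C) (u : Hom x (pb HC base_tgt base_src)) :
  let m := base_mk base_mul_src base_mul_tgt in
  [/\ base_src ∘ (m ∘ u) = base_src ∘ (pb_fst _ _ _ ∘ u),
      base_tgt ∘ (m ∘ u) = base_tgt ∘ (pb_snd _ _ _ ∘ u) &
      base_arr ∘ (m ∘ u) = ct (base_arr ∘ (pb_fst _ _ _ ∘ u))
                              (base_arr ∘ (pb_snd _ _ _ ∘ u))].
Proof.
move=> m; have [h1 h2 h3] := base_mkP base_mul_src base_mul_tgt.
rewrite !comp_assoc h1 h2 h3; split=> //.
rewrite icmpE ct_pre // sq //.
Qed.

Notation ids := (base_mkP base_idn_src base_idn_tgt).

Lemma base_src_idn : base_src ∘ base_mk base_idn_src base_idn_tgt = idm z.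
Proof. by have [-> _ _] := ids. Qed.

Lemma base_tgt_idn : base_tgt ∘ base_mk base_idn_src base_idn_tgt = idm z.
Proof. by have [_ -> _] := ids. Qed.

Lemma base_src_mul : base_src ∘ base_mk base_mul_src base_mul_tgt =
  base_src ∘ pb_fst HC base_tgt base_src.
Proof. by have [-> _ _] := base_mkP base_mul_src base_mul_tgt. Qed.

Lemma base_tgt_mul : base_tgt ∘ base_mk base_mul_src base_mul_tgt =
  base_tgt ∘ pb_snd HC base_tgt base_src.
Proof. by have [_ -> _] := base_mkP base_mul_src base_mul_tgt. Qed.

Definition base_change : IntCat HC.
Proof.
refine {| src_idn := base_src_idn; tgt_idn := base_tgt_idn;
  src_mul := base_src_mul; tgt_mul := base_tgt_mul |}.
- have [h1 h2 h3] := base_mulE (pb_pair HC (unit_l_ok base_src base_tgt_idn)).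
  have [i1 i2 i3] := ids.
  apply: base_ext; rewrite ?h1 ?h2 ?h3 ?pb_pair_fst ?pb_pair_snd ?comp_id_r //.
    by rewrite comp_assoc i1 comp_id_l.
  by rewrite comp_assoc i3 -comp_assoc ct_id_l // base_arr_src.
- have [h1 h2 h3] := base_mulE (pb_pair HC (unit_r_ok base_tgt base_src_idn)).
  have [i1 i2 i3] := ids.
  apply: base_ext; rewrite ?h1 ?h2 ?h3 ?pb_pair_fst ?pb_pair_snd ?comp_id_r //.
    by rewrite comp_assoc i2 comp_id_l.
  by rewrite comp_assoc i3 -comp_assoc ct_id_r // base_arr_tgt.
- have sq0 := pb_square HC base_tgt base_src.
  set p12 := pb_fst HC (pb_snd HC base_tgt base_src) (pb_fst HC base_tgt base_src).
  set p23 := pb_snd HC (pb_snd HC base_tgt base_src) (pb_fst HC base_tgt base_src).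
  have sq3 : pb_snd HC base_tgt base_src ∘ p12 = pb_fst HC base_tgt base_src ∘ p23.
    exact: pb_square.
  have [h1 h2 h3] := base_mulE (pb_pair HC (assoc_l_ok base_tgt_mul)).
  have [h4 h5 h6] := base_mulE (pb_pair HC (assoc_r_ok base_src_mul)).
  have [k1 k2 k3] := base_mulE p12; have [l1 l2 l3] := base_mulE p23.
  apply: base_ext; rewrite ?h1 ?h2 ?h3 ?h4 ?h5 ?h6 ?pb_pair_fst ?pb_pair_snd //.
  rewrite k3 l3 ct_assoc ?sq3 //; apply: base_composable.
    by rewrite -sq3 (comp_assoc base_tgt) (comp_assoc base_src) sq0.
  by rewrite (comp_assoc base_tgt) (comp_assoc base_src) sq0.
Defined.

Definition base_proj : IntFun base_change B.
Proof.
apply: (@IntFun_mk _ _ base_change B k base_arr).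
- exact: base_arr_src.
- exact: base_arr_tgt.
- by have [] := base_mkP base_idn_src base_idn_tgt.
- have [_ _ e] := base_mkP base_mul_src base_mul_tgt.
  by rewrite e icmpE.
Defined.

Lemma base_proj_ff : fully_faithful base_proj.
Proof.
apply/fully_faithfulP => x a a' f h1 h2.
have [u [u1 u2 u3]] := base_lift h1 h2.
exists u; split=> // v [v1 v2 v3].
by apply: base_ext; rewrite ?u1 ?u2 ?u3.
Qed.

End BaseChange.

Lemma fun0_comp A B D (G : IntFun B D) (F : IntFun A B) :
  fun0 (IntFun_comp G F) = fun0 G ∘ fun0 F.
Proof. by []. Qed.

Lemma fun1_comp A B D (G : IntFun B D) (F : IntFun A B) :
  fun1 (IntFun_comp G F) = fun1 G ∘ fun1 F.
Proof. by []. Qed.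

(** * The path object factorization *)

Section PathObject.
Variables (A B : IntCat HC) (F : IntFun A B).

Definition path_obj : Hom (PF0 F) (obs A) := pb_fst _ _ _.
Definition path_iso : Hom (PF0 F) (mors B) := iso_inc B ∘ pb_snd _ _ _.

Lemma path_isoP : internal_iso path_iso.
Proof. exact: internal_iso_pre (iso_inc_iso B). Qed.

Lemma path_iso_tgt : tgt B ∘ path_iso = fun0 F ∘ path_obj.
Proof.
rewrite /path_iso (comp_assoc (tgt B)).
by symmetry; exact: (pb_square HC (fun0 F) (tgt (iso B))).
Qed.

Lemma path_ext (z : C) (u v : Hom z (PF0 F)) : path_obj ∘ u = path_obj ∘ v ->
  path_iso ∘ u = path_iso ∘ v -> u = v.
Proof.
move=> h1 h2; apply: pb_ext => //; apply: iso_inc_mono.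
by move: h2; rewrite /path_iso -!(comp_assoc (iso_inc B)).
Qed.

Lemma path_lift (z : C) (a : Hom z (obs A)) (f : Hom z (mors B)) :
  internal_iso f -> tgt B ∘ f = fun0 F ∘ a ->
  exists u : Hom z (PF0 F), path_obj ∘ u = a /\ path_iso ∘ u = f.
Proof.
move=> hf e.
have e' : fun0 F ∘ a = tgt (iso B) ∘ iso_lift hf.
  by rewrite -e /= /iso_tgt -comp_assoc iso_liftK.
exists (pb_pair HC e'); split; first exact: pb_pair_fst.
by rewrite /path_iso -(comp_assoc (iso_inc B)) pb_pair_snd iso_liftK.
Qed.

Lemma comparison_obj :
  path_obj ∘ PF0_comparison F = tgt A ∘ iso_inc A.
Proof. exact: pb_pair_fst. Qed.

Lemma comparison_iso :
  path_iso ∘ PF0_comparison F = fun1 F ∘ iso_inc A.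
Proof.
by rewrite -iso_map1K /path_iso -(comp_assoc (iso_inc B)) pb_pair_snd.
Qed.

(** This is P_F, the iso-comma category of the identity of [B] and [F]. A morphism is recorded by
    its component in [A] alone, since the component in [B] is then forced by conjugation with the
    two isomorphisms. *)
Definition path_cat : IntCat HC := base_change path_obj.
Definition path_retr : IntFun path_cat A := base_proj path_obj.

Lemma path_retr_ff : fully_faithful path_retr.
Proof. exact: base_proj_ff. Qed.

Lemma path_section : exists u : Hom (obs A) (PF0 F),
  path_obj ∘ u = idm _ /\ path_iso ∘ u = idn B ∘ fun0 F.
Proof.
apply: path_lift; first exact: internal_iso_idn.
by rewrite tgt_idn_pre comp_id_r.
Qed.

Lemma path_retr_acyclic : acyclic_T_fibration HC tau path_cat A path_retr.
Proof.
apply/acyclic_fibrationP; split; first exact: path_retr_ff.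
by have [u [hu _]] := path_section; exists u.
Qed.

(** [J] sends a to a with the identity of F a. [Q] remembers the source of the isomorphism; it is F
    after [path_retr], conjugated by the generic isomorphism [path_iso], and [be] is the conjugating
    transformation. *)
Lemma path_factorization :
  exists (J : IntFun A path_cat) (Q : IntFun path_cat B)
         (be : IntNat Q (IntFun_comp F path_retr)),
    [/\ IntFun_comp path_retr J = IntFun_id A,
        path_obj ∘ fun0 J = idm _ /\ path_iso ∘ fun0 J = idn B ∘ fun0 F,
        F = IntFun_comp Q J, T_fibration HC tau path_cat B Q &
        nt be = path_iso].
Proof.
have [u [u1 u2]] := path_section.
have [|J [J1 J0]] := @ff_lift _ _ _ path_retr (IntFun_id A) u path_retr_ff.
  exact: u1.
have [|Q [be [Q0 eb]]] := @conj_functor _ _ (IntFun_comp F path_retr) path_iso path_isoP.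
  exact: path_iso_tgt.
exists J, Q, be; rewrite J0.
have eJ1 : fun1 path_retr ∘ fun1 J = idm _ by have := f_equal (@fun1 _ _ _ _) J1.
have eQ : F = IntFun_comp Q J.
{ apply: IntFun_eq.
  - by rewrite /= Q0 J0 -comp_assoc u2 src_idn_pre.
  - have := nt_natE be (fun1 J); rewrite eb fun1_comp fun_src fun_tgt.
    rewrite !(comp_assoc path_iso).
    rewrite J0 u2 -!comp_assoc eJ1 comp_id_r ct_id_l ?fun_src //.
    rewrite ct_id_r // fun_tgt_pre fun_tgt Q0 J0 -(comp_assoc (src B)).
    by rewrite (comp_assoc path_iso) u2 -comp_assoc src_idn_pre. }
split=> //.
apply/fibrationP => z a f hf; rewrite Q0 -comp_assoc => e.
(* To lift [f], keep the object of [A] and precompose its isomorphism with [f]; the lifted morphism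
   lies over an identity of [A]. *)
have hiso : internal_iso (ct f (path_iso ∘ a)).
  apply: internal_iso_ct => //; exact: internal_iso_pre path_isoP.
have [|a' [a1 a2]] := path_lift (a := path_obj ∘ a) hiso.
  by rewrite tgt_ct // (comp_assoc (tgt B)) path_iso_tgt -comp_assoc.
have [||g [g1 g2 g3]] := ff_full path_retr_ff (a := a') (a' := a)
   (f := idn A ∘ (path_obj ∘ a)).
  by rewrite src_idn_pre /= -a1.
  by rewrite tgt_idn_pre.
(* Naturality of [be] at [g] determines [fun1 Q ∘ g] up to the isomorphism [path_iso], which
   cancels. *)
have gf : fun1 Q ∘ g = f.
{ apply: (ct_cancel_r (internal_iso_pre a path_isoP)) => //.
    by rewrite fun_tgt_pre g2 Q0 -comp_assoc.
  have := nt_natE be g; rewrite eb g1 g2 => ->.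
  rewrite a2 fun1_comp -comp_assoc g3 fun_idn_pre ct_id_r // tgt_ct //.
  by rewrite (comp_assoc (tgt B)) path_iso_tgt -comp_assoc. }
exists g; split=> //.
by apply: (ff_reflects_iso path_retr_ff); rewrite g3; exact: internal_iso_idn.
Qed.

End PathObject.

(** * Whiskering and internal equivalences *)

Lemma IntFun_compA A B D E (H : IntFun D E) (G : IntFun B D) (F : IntFun A B) :
  IntFun_comp H (IntFun_comp G F) = IntFun_comp (IntFun_comp H G) F.
Proof. by apply: IntFun_eq; rewrite /= comp_assoc. Qed.

Lemma IntFun_comp1 A B (F : IntFun A B) : IntFun_comp F (IntFun_id A) = F.
Proof. by apply: IntFun_eq; rewrite /= comp_id_r. Qed.

Lemma IntFun_1comp A B (F : IntFun A B) : IntFun_comp (IntFun_id B) F = F.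
Proof. by apply: IntFun_eq; rewrite /= comp_id_l. Qed.

Definition nat_pre A B D (F G : IntFun B D) (al : IntNat F G)
  (H : IntFun A B) : IntNat (IntFun_comp F H) (IntFun_comp G H).
Proof.
apply: (@IntNat_mk _ _ _ _ (IntFun_comp F H) (IntFun_comp G H) (nt al ∘ fun0 H)).
- by rewrite nt_src_pre.
- by rewrite nt_tgt_pre.
- by rewrite -!comp_assoc -fun_src -fun_tgt; exact: nt_natE.
Defined.

Definition nat_post A B D (H : IntFun B D) (F G : IntFun A B)
  (al : IntNat F G) : IntNat (IntFun_comp H F) (IntFun_comp H G).
Proof.
apply: (@IntNat_mk _ _ _ _ (IntFun_comp H F) (IntFun_comp H G) (fun1 H ∘ nt al)).
- by rewrite fun_src_pre nt_src.
- by rewrite fun_tgt_pre nt_tgt.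
- rewrite !fun1_comp -!comp_assoc -!fun_ct ?nt_ct1 //.
    by rewrite fun_tgt comp_assoc nt_src.
  by rewrite fun_src comp_assoc nt_tgt.
Defined.

Lemma isomorphic_pre A B D (F G : IntFun B D) (H : IntFun A B) :
  @isomorphic (HomCat B D) F G ->
  @isomorphic (HomCat A D) (IntFun_comp F H) (IntFun_comp G H).
Proof.
move=> /isomorphicP[al hal]; apply/isomorphicP.
exists (nat_pre al H); exact: internal_iso_pre.
Qed.

Lemma isomorphic_post A B D (F G : IntFun A B) (H : IntFun B D) :
  @isomorphic (HomCat A B) F G ->
  @isomorphic (HomCat A D) (IntFun_comp H F) (IntFun_comp H G).
Proof.
move=> /isomorphicP[al hal]; apply/isomorphicP.
exists (nat_post H al); exact: internal_iso_fun.
Qed.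

Definition faithful A B (F : IntFun A B) : Prop :=
  forall (z : C) (f g : Hom z (mors A)), src A ∘ f = src A ∘ g ->
    tgt A ∘ f = tgt A ∘ g -> fun1 F ∘ f = fun1 F ∘ g -> f = g.

(** By naturality, f is the conjugate of G F f by the components of the isomorphism, hence is
    determined by F f and its ends. *)
Lemma retract_faithful A B (F : IntFun A B) (G : IntFun B A) :
  @isomorphic (HomCat A A) (IntFun_comp G F) (IntFun_id A) -> faithful F.
Proof.
move=> /isomorphicP[al hal] z f g es et e.
have h1 := nt_natE al f; have h2 := nt_natE al g.
rewrite /= !comp_id_l in h1 h2.
apply: (ct_cancel_l (internal_iso_pre (src A ∘ f) hal)).
- by rewrite nt_tgt_pre comp_id_l.
- by rewrite nt_tgt_pre comp_id_l.
- by rewrite -h1 es -h2 et -!comp_assoc e.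
Qed.

(* The preimage of f : F a -> F a' is eta_a^-1 ; G f ; eta_a'. *)
Lemma equivalence2_ff A B (F : IntFun A B) (G : IntFun B A) :
  @isomorphic (HomCat A A) (IntFun_comp G F) (IntFun_id A) ->
  @isomorphic (HomCat B B) (IntFun_comp F G) (IntFun_id B) ->
  fully_faithful F.
Proof.
move=> hGF hFG; have fF := retract_faithful hGF; have fG := retract_faithful hFG.
apply/fully_faithfulP => z a a' f hs ht.
have /isomorphicP[al hal] := hGF.
have /internal_isoP[k [k1 k2 k3 k4]] := hal.
rewrite nt_src nt_tgt in k1 k2 k3 k4.
have ka z' (x : Hom z' (obs A)) : [/\ src A ∘ (k ∘ x) = x,
    tgt A ∘ (k ∘ x) = fun0 G ∘ (fun0 F ∘ x) &
    ct (k ∘ x) (nt al ∘ x) = idn A ∘ x].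
{ split.
  - by rewrite comp_assoc -k1 comp_id_l.
  - by rewrite comp_assoc k2 /= comp_assoc.
  - rewrite -ct_pre ?k4 /= ?comp_id_r //.
    by rewrite nt_src. }
have [a1 a2 a3] := ka _ a.
have o1 : tgt A ∘ (k ∘ a) = src A ∘ (fun1 G ∘ f) by rewrite a2 fun_src_pre hs.
have o2 : tgt A ∘ (fun1 G ∘ f) = src A ∘ (nt al ∘ a').
  by rewrite fun_tgt_pre ht nt_src_pre /= comp_assoc.
pose g := ct (ct (k ∘ a) (fun1 G ∘ f)) (nt al ∘ a').
have gs : src A ∘ g = a by rewrite !src_ct // tgt_ct.
have gt : tgt A ∘ g = a' by rewrite tgt_ct ?tgt_ct // nt_tgt_pre /= comp_id_l.
have gF : fun1 F ∘ g = f.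
(* [G] is faithful as well, so it is enough to compare the images under [G], which naturality of
   [al] at [g] does. *)
{ apply: fG; first by rewrite fun_src_pre gs hs.
    by rewrite fun_tgt_pre gt ht.
  have o3 : tgt A ∘ (fun1 G ∘ (fun1 F ∘ g)) = src A ∘ (nt al ∘ a').
    by rewrite !fun_tgt_pre gt nt_src_pre /= comp_assoc.
  apply: (ct_cancel_r (internal_iso_pre a' hal)) => //.
  have := nt_natE al g; rewrite gs gt /= comp_id_l -comp_assoc => ->.
  have [l1 l2 l3 l4] : [/\ tgt A ∘ nt al = src A ∘ k, tgt A ∘ k = src A ∘ nt al,
      ct (nt al) k = idn A ∘ (src A ∘ nt al) & True] by split; rewrite ?nt_src ?nt_tgt.
  have p1 : tgt A ∘ (nt al ∘ a) = src A ∘ (k ∘ a) by rewrite !comp_assoc l1.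
  rewrite /g (ct_assoc o1 o2) -ct_assoc ?src_ct // -(ct_pre a l1) l3.
  rewrite -!comp_assoc nt_src_pre ct_id_l // src_ct // fun_src_pre hs /=.
  by rewrite comp_assoc. }
exists g; split=> // g' [h1 h2 h3].
by apply: fF; rewrite ?gs ?gt ?gF ?h1 ?h2 ?h3.
Qed.

(** From the chosen isomorphisms from b to F a, conjugating the identity of [B] by their inverses
    gives a functor with object part F a. It lifts through [F] to the quasi-inverse [G]. Then FGF ≅
    F lifts through [F] to GF ≅ 1. *)
Lemma equivalence_iff A B (F : IntFun A B) :
  T_equivalence HC tau A B F <-> @is_equivalence2 (CatC HC) A B F.
Proof.
rewrite equivalenceP; split=> [[ff [a [f [f1 f2 f3]]]]|[G [hGF hFG]]].
- have /internal_isoP[k [k1 k2 k3 k4]] := f1.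
  have hk : internal_iso k by apply/internal_isoP; exists f; rewrite k3 k4 k1 k2.
  have [|G' [al [h1 h2]]] := @conj_functor _ _ (IntFun_id B) k hk.
    by rewrite k2 f2.
  have [|G [g1 g2]] := @ff_lift _ _ _ F G' a ff.
    by rewrite h1 -k1 f3.
  have hFG : @isomorphic (HomCat B B) (IntFun_comp F G) (IntFun_id B).
    by rewrite g1; apply/isomorphicP; exists al; rewrite h2.
  exists G; split=> //.
  have := isomorphic_pre F hFG.
  have -> : IntFun_comp (IntFun_id B) F = IntFun_comp F (IntFun_id A).
    by rewrite IntFun_comp1 IntFun_1comp.
  rewrite -IntFun_compA => /isomorphicP[be hbe].
  have [ga e] := ff_lift_nat be ff.
  apply/isomorphicP; exists ga.
  by apply: (ff_reflects_iso ff); rewrite e.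
- split; first exact: equivalence2_ff hGF hFG.
  have /isomorphicP[al hal] := isomorphic_sym hFG.
  exists (fun0 G), (nt al); split=> //.
  + exact: nt_src.
  + exact: nt_tgt.
Qed.

Lemma IntFun_eq0 A B (F G : IntFun A B) : F = G -> fun0 F = fun0 G.
Proof. by move=> ->. Qed.

Lemma IntFun_eq1 A B (F G : IntFun A B) : F = G -> fun1 F = fun1 G.
Proof. by move=> ->. Qed.

Lemma id_equivalence A : T_equivalence HC tau A A (IntFun_id A).
Proof.
apply/equivalence_iff; exists (IntFun_id A).
by split; rewrite comp_id_l; exact: isomorphic_refl.
Qed.

(** [G] lifts the identity of [B] along a section on objects. Since FGF = F, the isomorphism GF ≅ 1
    is a lift of an identity transformation. *)
Lemma acyclic_fibration_section A B (F : IntFun A B) :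
  acyclic_T_fibration HC tau A B F <->
  exists G : IntFun B A, IntFun_comp F G = IntFun_id B /\
    @isomorphic (HomCat A A) (IntFun_comp G F) (IntFun_id A).
Proof.
rewrite acyclic_fibrationP; split=> [[ff [a ha]]|[G [hFG hGF]]].
- have [G [e _]] := @ff_lift _ _ _ F (IntFun_id B) a ff ha.
  exists G; split=> //.
  have e' : IntFun_comp F (IntFun_comp G F) = IntFun_comp F (IntFun_id A).
    by rewrite IntFun_compA e IntFun_comp1 IntFun_1comp.
  have /isomorphicP[al hal] : @isomorphic (HomCat A B)
      (IntFun_comp F (IntFun_comp G F)) (IntFun_comp F (IntFun_id A)).
    by rewrite e'; exact: isomorphic_refl.
  have [be e2] := ff_lift_nat al ff.
  by apply/isomorphicP; exists be; apply: (ff_reflects_iso ff); rewrite e2.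
- split; last by exists (fun0 G); exact: (IntFun_eq0 hFG).
  apply: equivalence2_ff hGF _; rewrite hFG; exact: isomorphic_refl.
Qed.

(** * Closure under retracts *)

(** By the characterization through quasi-inverses, [r ∘ G' ∘ j] works for the retract. *)
Lemma equivalence_retract_closed : retract_closed (T_equivalence HC tau).
Proof.
move=> A B X Y F G [i [r [j [s [ri sj Gi Fr]]]]] /equivalence_iff[G' [h1 h2]].
apply/equivalence_iff; exists (r ∘ G' ∘ j); split.
- have -> : r ∘ G' ∘ j ∘ F = r ∘ ((G' ∘ G) ∘ i) by rewrite -!comp_assoc Gi.
  rewrite -ri -[X in _ (r ∘ X)](comp_id_l i).
  exact: (isomorphic_post r (isomorphic_pre i h1)).
- have -> : F ∘ (r ∘ G' ∘ j) = s ∘ ((G ∘ G') ∘ j) by rewrite !comp_assoc Fr.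
  rewrite -sj -[X in _ (s ∘ X)](comp_id_l j).
  exact: (isomorphic_post s (isomorphic_pre j h2)).
Qed.

Lemma fibration_retract_closed : retract_closed (T_fibration HC tau).
Proof.
move=> A B X Y F G [i [r [j [s [ri sj Gi Fr]]]]] /fibrationP hG.
apply/fibrationP => z a f hf e.
have ri0 := IntFun_eq0 ri; have sj1 := IntFun_eq1 sj.
have Gi0 := IntFun_eq0 Gi; have Fr1 := IntFun_eq1 Fr.
rewrite /= in ri0 sj1 Gi0 Fr1.
have [|g [g1 g2 g3]] := hG z (fun0 i ∘ a) (fun1 j ∘ f) (internal_iso_fun j hf).
  by rewrite fun_tgt_pre e !comp_assoc Gi0.
exists (fun1 r ∘ g); split; first exact: internal_iso_fun.
- by rewrite fun_tgt_pre g2 comp_assoc ri0 comp_id_l.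
- by rewrite comp_assoc Fr1 -comp_assoc g3 comp_assoc sj1 comp_id_l.
Qed.

(** * Acyclic cofibrations lift against fibrations *)

Lemma path_section_equivalence A B (F : IntFun A B) (J : IntFun A (path_cat F)) :
  two_out_of_three (T_equivalence HC tau) ->
  IntFun_comp (path_retr F) J = IntFun_id A ->
  T_equivalence HC tau A (path_cat F) J.
Proof.
move=> W3 RJ; have wR := proj2 (path_retr_acyclic F).
have [_ _ w] := W3 _ _ _ J (path_retr F); apply: w => //.
have -> : @Defs.comp (Cat HC) _ _ _ (path_retr F) J = IntFun_id A by exact: RJ.
exact: id_equivalence.
Qed.

(* Lift [J] against the acyclic fibration [Q : P_i -> X]: the resulting
   [L : X -> P_i] packs [r] together with [th]. *)
Lemma cofibration_deformation A X (i : IntFun A X) :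
  two_out_of_three (T_equivalence HC tau) ->
  T_cofibration HC tau A X i -> T_equivalence HC tau A X i ->
  exists (r : IntFun X A) (th : IntNat (IntFun_id X) (IntFun_comp i r)),
    [/\ IntFun_comp r i = IntFun_id A, internal_iso (nt th) &
        nt th ∘ fun0 i = idn X ∘ fun0 i].
Proof.
move=> W3 hc hw.
have [J [Q [be [RJ [J0 J1] iQJ fQ ebe]]]] := path_factorization i.
have wJ := path_section_equivalence W3 RJ.
have [_ w2 _] := W3 _ _ _ J Q.
have wQ : T_equivalence HC tau _ _ Q.
  apply: w2 => //.
  by have <- : i = @Defs.comp (Cat HC) _ _ _ Q J.
have [|L [Li QL]] := hc _ _ Q (conj fQ wQ) J (IntFun_id X).
  by rewrite comp_id_l.
exists (IntFun_comp (path_retr i) L).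
(* Only the underlying morphism of the whiskered transformation is kept, so that its source [Q L]
   can be rewritten into the identity in its type. *)
have : nt (nat_pre be L) = nt be ∘ fun0 L by [].
move: (nat_pre be L); rewrite -IntFun_compA.
have -> : IntFun_comp Q L = IntFun_id X by exact: QL.
move=> ga ega; exists ga; rewrite ega ebe; split.
- rewrite -IntFun_compA.
  by have -> : IntFun_comp L i = J by exact: Li.
- exact: internal_iso_pre (path_isoP i).
- have := IntFun_eq0 Li; rewrite /= => e.
  by rewrite -comp_assoc e.
Qed.

(** The isomorphism v(th) goes from v x to v i r x = p u r x. Lifting it along [p] to an isomorphism
    [h] ending at u r x, trivially on A, and conjugating u r by [h] gives the filler. *)
Lemma acyclic_cofibration_lifts A X (i : IntFun A X) E D (p : IntFun E D) :
  two_out_of_three (T_equivalence HC tau) ->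
  T_cofibration HC tau A X i -> T_equivalence HC tau A X i ->
  T_fibration HC tau E D p -> @lifts (Cat HC) A X E D i p.
Proof.
move=> W3 hc hw hp u v /= sq.
have [r [th [ri hth thi]]] := cofibration_deformation W3 hc hw.
have sq0 := IntFun_eq0 sq; have sq1 := IntFun_eq1 sq.
have ri0 := IntFun_eq0 ri; rewrite /= in sq0 sq1 ri0.
(* [k] is the family of these lifting problems, indexed by the objects of [X]. *)
have [|k [k1 k2]] := @path_lift E D p _ (fun0 u ∘ fun0 r) (fun1 v ∘ nt th)
   (internal_iso_fun v hth).
  by rewrite fun_tgt_pre nt_tgt /= !comp_assoc sq0.
have [|W [W1 W0]] := @ff_lift _ _ _ (path_retr p) (IntFun_comp u r) k (path_retr_ff p).
  exact: k1.
pose c := PF0_comparison p.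
(* As [p] is a fibration, [c] is split epi. A section alone would not respect identities on A;
   lifting [i] against this acyclic fibration gives solutions that do, as [U] prescribes identities
   there. *)
have aq : acyclic_T_fibration HC tau _ _ (base_proj (B := path_cat p) c).
{ apply/acyclic_fibrationP; split; first exact: base_proj_ff.
  by apply/trivial_epiP. }
have [|U [U1 U0]] := @ff_lift _ _ _ (base_proj (B := path_cat p) c)
    (IntFun_comp W i) (idn (iso E) ∘ fun0 u) (base_proj_ff (B := path_cat p) c).
{ rewrite /= W0; apply: path_ext.
  all: rewrite !(comp_assoc (path_obj p), comp_assoc (path_iso p)).
  - rewrite comparison_obj k1 -(comp_assoc (tgt E)) (comp_assoc (iso_inc E)).
    by rewrite iso_inc_idn tgt_idn_pre -comp_assoc ri0 comp_id_r.
  - rewrite comparison_iso k2 -(comp_assoc (fun1 p)) -(comp_assoc (fun1 v)) thi.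
    by rewrite (comp_assoc (iso_inc E)) iso_inc_idn !fun_idn_pre sq0. }
have [H [Hi qH]] := hc _ _ _ aq U W U1.
pose h : Hom (obs X) (mors E) := iso_inc E ∘ fun0 H.
have hh : internal_iso h by exact: internal_iso_pre (iso_inc_iso E).
have cH : c ∘ fun0 H = k by rewrite -W0 -(IntFun_eq0 qH).
have ht : tgt E ∘ h = fun0 u ∘ fun0 r.
  by rewrite -k1 -cH /h (comp_assoc (tgt E)) (comp_assoc (path_obj p)) comparison_obj.
have ph : fun1 p ∘ h = fun1 v ∘ nt th.
  by rewrite -k2 -cH /h (comp_assoc (fun1 p)) (comp_assoc (path_iso p)) comparison_iso.
have hi : h ∘ fun0 i = idn E ∘ fun0 u.
{ have := IntFun_eq0 Hi; rewrite U0 /= /h => e.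
  by rewrite -(comp_assoc (iso_inc E)) e (comp_assoc (iso_inc E)) iso_inc_idn. }
clearbody h.
have [w [al [w0 eal]]] := @conj_functor _ _ (IntFun_comp u r) h hh ht.
have ri1 := IntFun_eq1 ri; rewrite /= in ri1.
exists w; split.
(* On A the conjugating isomorphism is an identity and r i = 1, so [w] restricts to [u]. *)
- apply: IntFun_eq; first by rewrite /= w0 -comp_assoc hi src_idn_pre.
  have := nt_natE al (fun1 i).
  rewrite eal fun_src fun_tgt !(comp_assoc h) hi fun1_comp -!comp_assoc.
  rewrite ri1 comp_id_r ct_id_l ?fun_src // ct_id_r //.
  by rewrite fun_tgt_pre fun_tgt w0 -(comp_assoc (src E)) (comp_assoc h) hi
    -comp_assoc src_idn_pre.
- have pw0 : fun0 p ∘ fun0 w = fun0 v.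
    by rewrite w0 -fun_src_pre ph fun_src_pre nt_src comp_id_r.
  have thp z (a : Hom z (obs X)) : internal_iso (fun1 v ∘ (nt th ∘ a)).
    by apply: internal_iso_fun; exact: internal_iso_pre.
  apply: IntFun_eq; first exact: pw0.
  (* Both p w and v are conjugates of p u r = v i r by the same isomorphism v(th). *)
  apply: (ct_cancel_r (thp _ (tgt X))).
  + by rewrite /= fun_tgt_pre fun_tgt fun_src_pre nt_src_pre comp_assoc pw0 comp_id_l.
  + by rewrite fun_tgt fun_src_pre nt_src_pre comp_id_l.
  + have o1 : tgt E ∘ fun1 w = src E ∘ (h ∘ tgt X) by rewrite fun_tgt w0 comp_assoc.
    have o2 : tgt E ∘ (h ∘ src X) = src E ∘ (fun1 u ∘ fun1 r).
      by rewrite fun_src_pre fun_src !comp_assoc ht.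
    rewrite /= comp_assoc -ph -comp_assoc -(fun_ct p o1).
    have := nt_ct1 al; rewrite eal fun1_comp => ->.
    rewrite (fun_ct p o2) (comp_assoc _ _ (src X)) ph (comp_assoc _ (fun1 u)) sq1.
    have := nt_ct1 th; rewrite /= => e.
    have o3 : tgt X ∘ idm _ = src X ∘ (nt th ∘ tgt X).
      by rewrite comp_id_r nt_src_pre comp_id_l.
    have o4 : tgt X ∘ (nt th ∘ src X) = src X ∘ (fun1 i ∘ fun1 r).
      by rewrite nt_tgt_pre /= fun_src_pre fun_src comp_assoc.
    rewrite -!comp_assoc -fun_ct // -e fun_ct // comp_id_r.
    by rewrite (comp_assoc (fun1 p)) ph -comp_assoc.
Qed.

(* Base change along [F, id]_0 : (A + B)_0 -> B_0; the copairing needed for the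
   lifting property is the object part of a functor out of the coproduct
   A + B of Cat(C). *)
Lemma cofibration_factorization (Hcolim : finitely_cocomplete (Cat HC)) A B
    (F : IntFun A B) :
  exists (E : IntCat HC) (i : IntFun A E) (p : IntFun E B),
    [/\ T_cofibration HC tau A E i, acyclic_T_fibration HC tau E B p &
        F = IntFun_comp p i].
Proof.
have [S [s1 [s2 US]]] := coproduct_exists Hcolim A B.
have [G [[G1 G2] _]] := US B F (IntFun_id B).
have G10 := IntFun_eq0 G1; have G20 := IntFun_eq0 G2; rewrite /= in G10 G20.
pose p := base_proj (fun0 G).
have ffp : fully_faithful p := base_proj_ff _.
have [i [i1 i0]] := @ff_lift _ _ _ p F (fun0 s1) ffp G10.
(* The comparison from the coproduct to the base change; it is the identity on objects. *)
have [|Ga [Ga1 Ga0]] := @ff_lift _ _ _ p G (idm _) ffp; first exact: comp_id_r.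
exists (base_change (fun0 G)), i, p; split=> //; last first.
  by apply/acyclic_fibrationP; split=> //; exists (fun0 s2).
move=> X Y q /acyclic_fibrationP[ffq [a ha]] u v /= sq.
have sq0 := IntFun_eq0 sq; rewrite /= in sq0.
(* On the summand B nothing is prescribed, so a section of [q] on objects gives some lift [t], to be
   copaired with [u]. *)
have [|t [t1 t0]] := @ff_lift _ _ _ q (IntFun_comp (IntFun_comp v Ga) s2)
    (a ∘ fun0 (IntFun_comp (IntFun_comp v Ga) s2)) ffq.
  by rewrite comp_assoc ha comp_id_l.
have Gs1 : IntFun_comp Ga s1 = i.
  apply: (ff_lift_unique ffp); last by rewrite /= Ga0 comp_id_l.
  by rewrite IntFun_compA Ga1 i1; exact: G1.
have [H [[H1 H2] _]] := US X u t.
have qH : IntFun_comp q H = IntFun_comp v Ga.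
  have [w [_ uw]] := US Y (IntFun_comp q u) (IntFun_comp q t).
  have e1 : w = IntFun_comp q H.
    by apply: uw; split; [rewrite -H1|rewrite -H2]; exact: esym (IntFun_compA _ _ _).
  rewrite -e1; apply: uw; split; last by rewrite t1.
  by rewrite sq -Gs1; exact: esym (IntFun_compA _ _ _).
have qH0 := IntFun_eq0 qH; rewrite /= Ga0 comp_id_r in qH0.
(* The base change has the objects of the coproduct, so the object part of [H] is a lift of that of
   [v], which full faithfulness of [q] extends to a functor. *)
have [h [h1 h0]] := @ff_lift _ _ _ q v (fun0 H) ffq qH0.
exists h; split=> //; apply: (ff_lift_unique ffq).
  by rewrite IntFun_compA h1 -sq.
by rewrite /= h0 i0; exact: (IntFun_eq0 H1).
Qed.

(** * The model structure; fibrant and cofibrant objects *)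

Lemma factorization (Hcolim : finitely_cocomplete (Cat HC)) A B
    (F : IntFun A B) : two_out_of_three (T_equivalence HC tau) ->
  exists (E : IntCat HC) (i : IntFun A E) (q : IntFun E B),
    [/\ T_cofibration HC tau A E i, T_equivalence HC tau A E i,
        T_fibration HC tau E B q & F = IntFun_comp q i].
Proof.
move=> W3; have [J [Q [be [RJ _ FQJ fQ _]]]] := path_factorization F.
have wJ := path_section_equivalence W3 RJ.
have [E [i [p [ci [fp wp] eJ]]]] := cofibration_factorization Hcolim J.
exists E, i, (IntFun_comp Q p); split=> //; last by rewrite -IntFun_compA -eJ.
- have [_ _ w2] := W3 _ _ _ i p; apply: w2 => //.
  by have <- : J = @Defs.comp (Cat HC) _ _ _ p i.
- apply/fibrationP => z a f hf e; rewrite fun0_comp -comp_assoc in e.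
  have [g [g1 g2 g3]] := proj1 (fibrationP Q) fQ _ _ _ hf e.
  have [g' [h1 h2 h3]] := proj1 (fibrationP p) fp _ _ _ g1 g2.
  by exists g'; split=> //; rewrite fun1_comp -comp_assoc h3.
Qed.

(** Once liftings and factorizations are available, the remaining implications follow from the
    retract argument and closure under retracts. *)
Lemma model_structure (Hcolim : finitely_cocomplete (Cat HC)) :
  two_out_of_three (T_equivalence HC tau) ->
  is_model_structure (T_equivalence HC tau) (T_cofibration HC tau)
    (T_fibration HC tau).
Proof.
move=> W3; split=> //; first exact: equivalence_retract_closed.
- split=> [A B F|A B F|A B F].
  + split=> [[hc hw] X Y p hp|hl].
      exact: acyclic_cofibration_lifts.
    have [E [i [q [ci wi fq e]]]] := factorization Hcolim F W3.
    split; first by move=> X Y p [hp _]; exact: hl.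
    apply: equivalence_retract_closed wi.
    exact: (@lifts_retract_left (Cat HC) _ _ _ F i q e (hl _ _ _ fq)).
  + split=> [hf X Y i [ci wi]|hl].
      exact: acyclic_cofibration_lifts.
    have [E [i [q [ci wi fq e]]]] := factorization Hcolim F W3.
    apply: fibration_retract_closed fq.
    exact: (@lifts_retract_right (Cat HC) _ _ _ F i q e (hl _ _ _ (conj ci wi))).
  + have [E [i [q [ci wi fq e]]]] := factorization Hcolim F W3.
    by exists E, i, q.
- split=> [A B F|A B F|A B F] //.
  + split=> [hf X Y i ci|hl]; first exact: ci.
    have [E [i [p [ci [fp wp] e]]]] := cofibration_factorization Hcolim F.
    have re := @lifts_retract_right (Cat HC) _ _ _ F i p e (hl _ _ _ ci).
    split; [exact: fibration_retract_closed re fp|].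
    exact: equivalence_retract_closed re wp.
  + have [E [i [p [ci ap e]]]] := cofibration_factorization Hcolim F.
    by exists E, i, p.
Qed.

(** An acyclic cofibration has a retraction [r], so [u ∘ r] extends [u]; maps to a terminal object
    agree. *)
Lemma all_fibrant (Hcolim : finitely_cocomplete (Cat HC)) (A : Cat HC) :
  two_out_of_three (T_equivalence HC tau) -> fibrant (T_fibration HC tau) A.
Proof.
move=> W3 t f ht; have [_ _ [_ h _] _] := model_structure Hcolim W3.
apply/h => X Y i [ci wi] u v _.
have [r [th [ri _ _]]] := cofibration_deformation W3 ci wi.
exists (u ∘ (r : @Hom (Cat HC) Y X)); split.
  rewrite -comp_assoc; have -> : @Defs.comp (Cat HC) _ _ _ r i = idm X by [].
  exact: comp_id_r.
have [w [_ uw]] := ht Y.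
by rewrite -(uw v) // -(uw (f ∘ _)).
Qed.

(** Dually, compose with a section of the acyclic fibration. *)
Lemma all_cofibrant (A : Cat HC) : cofibrant (T_cofibration HC tau) A.
Proof.
move=> o f ho X Y p /acyclic_fibration_section[G [pG _]] u v _.
exists ((G : @Hom (Cat HC) Y X) ∘ v); split.
  have [w [_ uw]] := ho X.
  by rewrite -(uw u) // -(uw (_ ∘ f)).
rewrite comp_assoc; have -> : @Defs.comp (Cat HC) _ _ _ p G = idm Y by [].
exact: comp_id_l.
Qed.

(** * Comparison with the trivial model structure *)

Lemma existT_nat_eq A B (F F' G : IntFun A B) (al : IntNat F G)
    (be : IntNat F' G) : F = F' -> nt al = nt be ->
  existT (fun K => IntNat K G) F al = existT (fun K => IntNat K G) F' be.
Proof. by move=> e; case: _ / e be => be /IntNat_eq ->. Qed.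

Lemma existT_nat_inj A B (F F' G : IntFun A B) (al : IntNat F G)
    (be : IntNat F' G) :
  existT (fun K => IntNat K G) F al = existT (fun K => IntNat K G) F' be ->
  nt al = nt be.
Proof. exact: (f_equal (fun s => nt (projT2 s))). Qed.

(* [postcomp] whiskers with the identity 2-cell of [F], so on 2-cells it is
   only propositionally given by [fun1 F ∘ nt al]. *)
Definition post_functor E A B (F : IntFun A B) :
  Functor (HomCat E A) (HomCat E B).
Proof.
exists (IntFun_comp F : HomCat E A -> HomCat E B) (fun _ _ al => nat_post F al).
- move=> a; apply: IntNat_eq; exact: fun_idn_pre.
- move=> a b c be al; apply: IntNat_eq; rewrite /= !icmpE.
  exact: fun_ct (nt_ok be al).
Defined.

Lemma postcompE E A B (F : IntFun A B) :
  @postcomp (CatC HC) E A B F = post_functor E F.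
Proof.
apply: HomCat_functor_eq => // a b al.
rewrite /= icmpE -comp_assoc ct_id_r //.
by rewrite fun_tgt_pre nt_tgt.
Qed.

(** Forwards, lift the components and conjugate. Backwards, the test object is P_F with the generic
    isomorphism [be]; evaluating its lift at the element of [PF0 F] given by [(a, f)] solves that
    problem. *)
Lemma fibration_iff A B (F : IntFun A B) : T_fibration HC tau A B F <->
  forall E : CatC HC, is_isofibration (@postcomp (CatC HC) E A B F).
Proof.
rewrite fibrationP; split=> [h E|h z a f hf e].
- rewrite postcompE => a b be /nat_isoP hbe.
  have [g [g1 g2 g3]] := h _ (fun0 a) (nt be) hbe (nt_tgt be).
  have [a' [al [a0 eal]]] := conj_functor g1 g2.
  exists a', al; split; first by apply/nat_isoP; rewrite eal.
  have ea : IntFun_comp F a' = b.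
  (* F a' and b agree on morphisms because both are the conjugate of F a by [be]. *)
  { have e0 : fun0 (IntFun_comp F a') = fun0 b.
      by rewrite fun0_comp a0 -fun_src_pre g3 nt_src.
    apply: IntFun_eq => //.
    apply: (ct_cancel_r (internal_iso_pre (tgt E) hbe)).
    - by rewrite fun_tgt e0 nt_src_pre.
    - by rewrite fun_tgt nt_src_pre.
    - rewrite (nt_ct1 be) -g3 -eal.
      have o1 : tgt A ∘ fun1 a' = src A ∘ (nt al ∘ tgt E).
        by rewrite fun_tgt nt_src_pre.
      have o2 : tgt A ∘ (nt al ∘ src E) = src A ∘ fun1 a.
        by rewrite fun_src nt_tgt_pre.
      by rewrite -!comp_assoc -(fun_ct F o1) nt_ct1 (fun_ct F o2). }
  apply: existT_nat_eq; first exact: ea.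
  by rewrite /= eal.
- have [J [Q [be [_ _ _ _ eb]]]] := path_factorization F.
  have hbe : @is_iso (HomCat _ _) Q (IntFun_comp F (path_retr F)) be.
    by apply/nat_isoP; rewrite eb; exact: path_isoP.
  have := h (path_cat F); rewrite postcompE => hF.
  have [a' [al [/nat_isoP hal eq]]] := hF (path_retr F) Q be hbe.
  have [k [k1 k2]] := path_lift hf e.
  have e1 : fun1 F ∘ nt al = nt be := existT_nat_inj eq.
  exists (nt al ∘ k); split; first exact: internal_iso_pre.
  + by rewrite nt_tgt_pre.
  + by rewrite comp_assoc e1 eb.
Qed.

(** [T] is related to composition with [H] only by propositional equalities, so each component is
    transported along them and then chosen, keeping its underlying morphism. *)
Lemma nat_iso_to_id E A (H : IntFun A A)
    (T : Functor (HomCat E A) (HomCat E A)) :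
  @isomorphic (HomCat A A) H (IntFun_id A) ->
  (forall a : HomCat E A, T a = IntFun_comp H a) ->
  (forall (a b : HomCat E A) (al : Hom a b), nt (fmap T al) = fun1 H ∘ nt al) ->
  nat_iso T (Fid (HomCat E A)).
Proof.
move=> /isomorphicP[et het] hT0 hT1.
have h (a : HomCat E A) : exists be : IntNat (T a) a, nt be = nt et ∘ fun0 a.
  have : nt (nat_pre et a) = nt et ∘ fun0 a by [].
  by move: (nat_pre et a); rewrite IntFun_1comp -hT0 => be; exists be.
pose w a := proj1_sig (constructive_indefinite_description _ (h a)).
have hw a : nt (w a) = nt et ∘ fun0 a.
  by rewrite /w; case: constructive_indefinite_description.
exists w; split=> [a b al|a]; last first.
  by apply/nat_isoP; rewrite hw; exact: internal_iso_pre.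
apply: IntNat_eq; rewrite /= !icmpE !hw hT1.
by have := nt_natE et (nt al); rewrite nt_src nt_tgt /= comp_id_l.
Qed.

(** The converse is a Yoneda argument: at E = B essential surjectivity over the identity gives [G]
    with FG ≅ 1, and at E = A the isomorphism FGF ≅ F is reflected to GF ≅ 1. *)
Lemma equivalence2_iff A B (F : IntFun A B) : @is_equivalence2 (CatC HC) A B F <->
  forall E : CatC HC, is_equivalence (@postcomp (CatC HC) E A B F).
Proof.
split=> [[G [h1 h2]] E|h].
- rewrite postcompE; exists (post_functor E G); split.
  + apply: (nat_iso_to_id h1) => [a|a b al]; first exact: IntFun_compA.
    exact: comp_assoc.
  + apply: (nat_iso_to_id h2) => [a|a b al]; first exact: IntFun_compA.
    exact: comp_assoc.
- have := h B; rewrite postcompE => -[G [_ [w [_ hw]]]].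
  have h2 : @isomorphic (HomCat B B) (IntFun_comp F (G (IntFun_id B))) (IntFun_id B).
    by exists (w (IntFun_id B)); exact: hw.
  exists (G (IntFun_id B)); split=> //.
  have := h A; rewrite postcompE => hA.
  apply: (equivalence_reflects_isomorphic hA).
  have := isomorphic_pre F h2; rewrite -IntFun_compA.
  have -> : IntFun_comp (IntFun_id B) F = IntFun_comp F (IntFun_id A).
    by rewrite IntFun_1comp IntFun_comp1.
  exact: id.
Qed.

End InternalCategories.

Theorem theorem8p50 (C : Category) (HC : finitely_complete C)
    (Hlim : finitely_complete (Cat HC)) (Hcolim : finitely_cocomplete (Cat HC)) :
  let tau := trivial_topology C in
  let We := T_equivalence HC tau in
  let Fib := T_fibration HC tau in
  let Cof := T_cofibration HC tau in
  (* (i) *)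
  (forall (e b : C) (p : Hom e b),
     T_epi tau p <-> exists q : Hom b e, p ∘ q = idm b) /\
  (* (ii) *)
  (forall (A B : Cat HC) (F : Hom A B),
     Fib A B F /\ We A B F <->
     exists G : Hom B A,
       F ∘ G = idm B /\ @isomorphic (@HomC (CatC HC) A A) (G ∘ F) (idm A)) /\
  (* (iii) *)
  ((forall P : C, T_projective tau P) /\ enough_T_projectives tau) /\
  (two_out_of_three We ->
   (* (iv) *)
   is_model_structure We Cof Fib /\
   (* (v) *)
   (forall A : Cat HC, fibrant Fib A /\ cofibrant Cof A) /\
   (* (vi) *)
   (forall (A B : Cat HC) (F : Hom A B),
      We A B F <-> is_equivalence2 (K := CatC HC) F) /\
   (* (vii) *)
   (is_trivial_model_structure (K := CatC HC) We Cof Fib /\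
    forall W' Cof' Fib' : mor_class (Cat HC),
      is_trivial_model_structure (K := CatC HC) W' Cof' Fib' ->
      forall (A B : Cat HC) (F : Hom A B),
        [/\ We A B F <-> W' A B F, Cof A B F <-> Cof' A B F &
            Fib A B F <-> Fib' A B F])).
Proof.
move=> tau We Fib Cof.
split; first by move=> e b p; exact: trivial_epiP.
split; first by move=> A B F; exact: acyclic_fibration_section.
have proj P : T_projective tau P.
  move=> q r G /trivial_epiP[s hs] H; exists (s ∘ H).
  by rewrite comp_assoc hs comp_id_l.
split.
  split=> // b; exists b, (idm b); split=> //.
  by apply/trivial_epiP; exists (idm b); rewrite comp_id_l.
move=> W3; have M := model_structure Hcolim W3.
split=> //; split.
  by move=> A; split; [exact: all_fibrant|exact: all_cofibrant].
split; first by move=> A B F; exact: equivalence_iff.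
split.
  split=> // A B F; last exact: fibration_iff.
  by rewrite -equivalence2_iff; exact: equivalence_iff.
(* Weak equivalences and fibrations are prescribed by the representable functors; cofibrations are
   then the left lifting class of the acyclic fibrations in both structures. *)
move=> W' Cof' Fib' [[_ _ _ [hc _ _]] hw hf] A B F.
have ww X Y (G : IntFun X Y) : We X Y G <-> W' X Y G.
  by rewrite hw -equivalence2_iff; exact: equivalence_iff.
have ff X Y (G : IntFun X Y) : Fib X Y G <-> Fib' X Y G.
  by rewrite hf; exact: fibration_iff.
split; [exact: ww| |exact: ff].
rewrite hc; split=> h X Y p [h1 h2]; apply: h; split; by [apply/ff|apply/ww].
Qed.
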